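(* Consider an affine control system $$\dot{x}(t)=A_{0}x(t)+a_{0}+\sum_{i=1}^{m}u_{i}(t)[A_{i}x(t)+a_{i}],\quad u\in\mathcal{U},$$ on $\mathbb{R}^{n}$. Assume for the central chain control set ${}_{\mathbb{P}}E_{c}$ in $\mathbb{P}^{n}$ that the intersection with $\mathbb{P}^{n,0}$ is ${}_{\mathbb{P}}E^{\hom}\times\{0\}$ for a single chain control set ${}_{\mathbb{P}}E^{\hom}\subset\mathbb{P}^{n-1}$ of the homogeneous part, and that the preimage in $\mathbb{S}^{n-1}$ of ${}_{\mathbb{P}}E^{\hom}$ is a single chain control set ${}_{\mathbb{S}}E_{0}^{\hom}$. (i) Suppose that the preimage in $\mathbb{S}^{n}$ of ${}_{\mathbb{P}}E_{c}$ is a single chain control set ${}_{\mathbb{S}}E_{c,0}$. Then the intersection ${}_{\mathbb{S}}E_{c,0}\cap\overline{\mathbb{S}^{n,+}}$ is the unique chain control set in $\overline{\mathbb{S}^{n,+}}$ which is not contained in the equator $\mathbb{S}^{n,0}$. (ii) Suppose that the preimage in $\mathbb{S}^{n}$ of ${}_{\mathbb{P}}E_{c}$ is the union of two chain control sets ${}_{\mathbb{S}}E_{c,1}$ and ${}_{\mathbb{S}}E_{c,2}$. Then every chain control set in $\overline{\mathbb{S}^{n,+}}$ which is not contained in $\mathbb{S}^{n,0}$ coincides with ${}_{\mathbb{S}}E_{c,1}\cap\overline{\mathbb{S}^{n,+}}$ or ${}_{\mathbb{S}}E_{c,2}\cap\overline{\mathbb{S}^{n,+}}$.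
   Context: Setting. $A_i\in\mathbb{R}^{n\times n}$, $a_i\in\mathbb{R}^n$, $i=0,\ldots,m$; $\Omega\subset\mathbb{R}^m$ is a convex and compact neighborhood of $0$; $\mathcal{U}=\{u\in L^\infty(\mathbb{R},\mathbb{R}^m)\mid u(t)\in\Omega\text{ for almost all }t\}$. For $0\ne y\in\mathbb{R}^{k}$, $\mathbb{P}y\in\mathbb{P}^{k-1}$ is its class in projective space. A bilinear control system $\dot y=[B_0+\sum u_iB_i]y$ on $\mathbb{R}^k$ with trajectories $\varphi(t,y,u)$ induces control systems on the unit sphere $\mathbb{S}^{k-1}$ with trajectories $\varphi(t,s,u)/\|\varphi(t,s,u)\|$ and on $\mathbb{P}^{k-1}$ with trajectories $\mathbb{P}\varphi(t,y,u)$. The homogeneous part of the affine system is $\dot x=[A_0+\sum_{i}u_iA_i]x$ on $\mathbb{R}^n$; it induces systems on $\mathbb{S}^{n-1}$ and $\mathbb{P}^{n-1}$. The affine system is embedded in the bilinear system on $\mathbb{R}^{n+1}$ with matrices $\begin{pmatrix}A_i&a_i\\0&0\end{pmatrix}$, $i=0,\ldots,m$; this induces the systems on the Poincaré sphere $\mathbb{S}^n$ and on $\mathbb{P}^n$ considered here. Put $\mathbb{S}^{n,+}=\{s\in\mathbb{S}^n\mid s_{n+1}>0\}$, $\mathbb{S}^{n,0}=\{s\in\mathbb{S}^n\mid s_{n+1}=0\}$, $\overline{\mathbb{S}^{n,+}}=\mathbb{S}^{n,+}\cup\mathbb{S}^{n,0}$, $\mathbb{P}^{n,1}=\{\mathbb{P}(x,1)\mid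 x\in\mathbb{R}^n\}$, $\mathbb{P}^{n,0}=\{\mathbb{P}(x,0)\mid 0\ne x\in\mathbb{R}^n\}$; these sets are invariant. $\mathbb{S}^{n-1}\times\{0\}$ is identified with $\mathbb{S}^{n,0}$, and for $F\subset\mathbb{P}^{n-1}$, $F\times\{0\}$ denotes $\{\mathbb{P}(x,0)\mid\mathbb{P}x\in F\}\subset\mathbb{P}^{n,0}$. Preimages are with respect to $s\mapsto\mathbb{P}s$. Spheres and their subsets carry the metric $d(s,s')=\max_i|s_i-s_i'|$, projective spaces the metric $d(\mathbb{P}s,\mathbb{P}s')=\min\{d(s,s'),d(s,-s')\}$. Chain control sets (for a control system on a metric space $M$ with trajectories $\varphi_M(t,x,u)$). For constants $\varepsilon,T>0$ a controlled $(\varepsilon,T)$-chain from $x$ to $y$ in $M$ consists of $k\ge1$, $x_0=x,\ldots,x_k=y\in M$, $u_0,\ldots,u_{k-1}\in\mathcal{U}$, $T_0,\ldots,T_{k-1}\ge T$ with $d(\varphi_M(T_j,x_j,u_j),x_{j+1})<\varepsilon$ for all $j$. A nonvoid set $E\subset M$ is a chain control set if for all $x,y\in E$ and $\varepsilon,T>0$ there is a controlled $(\varepsilon,T)$-chain in $M$ from $x$ to $y$, and $E$ is maximal with this property. Chain control sets in $\overline{\mathbb{S}^{n,+}}$ are those of the system restricted to $M=\overline{\mathbb{S}^{n,+}}$. Central chain control set: it is known that there is a unique chain control set ${}_{\mathbb{P}}E_c$ of the system on $\mathbb{P}^n$ with ${}_{\mathbb{P}}E_c\cap\mathbb{P}^{n,1}\ne\varnothing$;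 it is called the central chain control set. *)

(* Defs.v *)
From HB Require Import structures.
From mathcomp Require Import all_boot all_order all_algebra.
From mathcomp Require Import all_classical all_reals all_analysis.
Set Implicit Arguments.
Unset Strict Implicit.
Unset Printing Implicit Defensive.
Import Order.TTheory GRing.Theory Num.Theory.
Import numFieldNormedType.Exports.
Local Open Scope classical_set_scope.
Local Open Scope ring_scope.

Section ControlSystem.
Variables (R : realType) (m : nat).

Definition control := R -> 'cV[R]_m.

(* Functions rather than their almost-everywhere classes: trajectories do not
   depend on the representative. *)
Definition admissible (Omega : set 'cV[R]_m) : set control :=
  [set u : control | (forall i, (fun t : R => u t i ord0) \in Lfun lebesgue_measure +oo%E)
           /\ {ae lebesgue_measure, forall t, Omega (u t)}].

(* [flow S t x u z] means that z is phi_M(t, x, u), M being [states S]. The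
   trajectory map is given by its graph: by Caratheodory's theorem the
   equations below have exactly one solution for each initial value. *)
Record csystem (X : Type) := CSystem {
  states : set X;
  dist : X -> X -> R;
  flow : R -> X -> control -> X -> Prop }.

Definition restrict_to X (S : csystem X) (M : set X) : csystem X :=
  CSystem M (dist S) (flow S).

Definition chain (Omega : set 'cV[R]_m) X (S : csystem X) (eps T : R)
    (x y : X) : Prop :=
  exists (k : nat) (xs : nat -> X) (us : nat -> control) (ts : nat -> R),
    [/\ (1 <= k)%N, xs 0%N = x, xs k = y,
        forall j, (j <= k)%N -> states S (xs j)
      & forall j, (j < k)%N ->
          [/\ admissible Omega (us j), T <= ts j
            & exists2 z, flow S (ts j) (xs j) (us j) z
                         & dist S z (xs j.+1) < eps]].

Definition chain_transitive (Omega : set 'cV[R]_m) X (S : csystem X)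
    (E : set X) : Prop :=
  forall x y, E x -> E y ->
  forall eps T : R, 0 < eps -> 0 < T -> chain Omega S eps T x y.

Definition chain_control_set (Omega : set 'cV[R]_m) X (S : csystem X)
    (E : set X) : Prop :=
  [/\ E !=set0, E `<=` states S, chain_transitive Omega S E
    & forall E', E `<=` E' -> E' `<=` states S ->
        chain_transitive Omega S E' -> E' = E].

End ControlSystem.

Section Spaces.
Variables (R : realType) (k : nat).

(* The norm `|s| of a column vector is max_i |s i|; the unit sphere is taken
   for the Euclidean norm, and its metric is `|s - s'|. *)
Definition enorm (y : 'cV[R]_k) : R := Num.sqrt (\sum_i y i ord0 ^+ 2).

Definition sphere : set 'cV[R]_k := [set s | enorm s = 1].

Definition Proj (y : 'cV[R]_k) : set 'cV[R]_k :=
  [set c *: y | c in [set c : R | c != 0]].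

Definition proj_space : set (set 'cV[R]_k) :=
  [set Proj y | y in [set y | y != 0]].

Definition unit_rep (p : set 'cV[R]_k) : 'cV[R]_k := get (p `&` sphere).

Definition pdist (p q : set 'cV[R]_k) : R :=
  let s := unit_rep p in let s' := unit_rep q in
  Num.min `|s - s'| `|s - (- s')|.

Definition preim_sphere (F : set (set 'cV[R]_k)) : set 'cV[R]_k :=
  [set s | sphere s /\ F (Proj s)].

Lemma enormZ (c : R) (y : 'cV[R]_k) : enorm (c *: y) = `|c| * enorm y.
Proof.
rewrite /enorm -sqrtr_sqr -sqrtrM ?sqr_ge0// mulr_sumr.
by congr Num.sqrt; apply: eq_bigr => i _; rewrite mxE exprMn.
Qed.

Lemma unit_repP (s : 'cV[R]_k) : sphere s ->
  unit_rep (Proj s) = s \/ unit_rep (Proj s) = - s.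
Proof.
move=> s1; rewrite /unit_rep; have [] : (Proj s `&` sphere) (get (Proj s `&` sphere)).
  by apply: (@getPex _ (Proj s `&` sphere)); exists s; split => //; exists 1;
    rewrite ?scale1r //=; exact: oner_neq0.
move: (get _) => r [c _ <-]; rewrite /sphere /= enormZ s1 mulr1 => /eqP.
rewrite eqr_norml ler01 andbT => /orP[]/eqP->; first by left; rewrite scale1r.
by right; rewrite scaleN1r.
Qed.

(* [pdist] does not depend on the unit representatives it picks. *)
Lemma pdistE (s s' : 'cV[R]_k) : sphere s -> sphere s' ->
  pdist (Proj s) (Proj s') = Num.min `|s - s'| `|s - (- s')|.
Proof.
move=> hs hs'; rewrite /pdist.
have e1 : `|- s - s'| = `|s - - s'| by rewrite -opprD normrN opprK.
have e2 : `|- s - - s'| = `|s - s'| by rewrite -opprD normrN.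
case: (unit_repP hs) => ->; case: (unit_repP hs') => -> //.
- by rewrite (opprK (- s')) minC.
- by rewrite e1 e2 minC.
- by rewrite (opprK (- s')) e1 e2.
Qed.

End Spaces.

Section Bilinear.
Variables (R : realType) (m k : nat) (B : 'I_m.+1 -> 'M[R]_k).

Definition rhs (v : 'cV[R]_m) : 'M[R]_k :=
  B ord0 + \sum_(i < m) v i ord0 *: B (lift ord0 i).

(* Caratheodory solutions on the whole line, in integral form. *)
Definition solution (u : control R m) (y : R -> 'cV[R]_k) : Prop :=
  continuous y /\
  forall (a b : R) (i : 'I_k), a <= b ->
    y b i ord0 - y a i ord0 =
    \int[lebesgue_measure]_(t in `[a, b]) (rhs (u t) *m y t) i ord0.

Definition sphere_flow (t : R) (s : 'cV[R]_k) (u : control R m)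
    (s' : 'cV[R]_k) : Prop :=
  exists y, [/\ solution u y, y 0 = s & s' = (enorm (y t))^-1 *: y t].

Definition proj_flow (t : R) (p : set 'cV[R]_k) (u : control R m)
    (q : set 'cV[R]_k) : Prop :=
  exists y, [/\ solution u y, y 0 != 0, p = Proj (y 0) & q = Proj (y t)].

Definition sphere_system : csystem R m 'cV[R]_k :=
  CSystem (@sphere R k) (fun s s' => `|s - s'|) sphere_flow.

Definition proj_system : csystem R m (set 'cV[R]_k) :=
  CSystem (@proj_space R k) (@pdist R k) proj_flow.

End Bilinear.

Section Affine.
Variables (R : realType) (m n : nat).
Variables (A : 'I_m.+1 -> 'M[R]_n) (a : 'I_m.+1 -> 'cV[R]_n).

Definition embed (i : 'I_m.+1) : 'M[R]_(n + 1) := block_mx (A i) (a i) 0 0.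

Definition last_coord (s : 'cV[R]_(n + 1)) : R := s (rshift n ord0) ord0.

Definition upper_hemi : set 'cV[R]_(n + 1) :=
  [set s | sphere s /\ 0 < last_coord s].

Definition equator : set 'cV[R]_(n + 1) :=
  [set s | sphere s /\ last_coord s = 0].

Definition closed_hemi : set 'cV[R]_(n + 1) := upper_hemi `|` equator.

Definition Pn1 : set (set 'cV[R]_(n + 1)) :=
  [set Proj (col_mx x 1%:M) | x in [set: 'cV[R]_n]].

Definition Pn0 : set (set 'cV[R]_(n + 1)) :=
  [set Proj (col_mx x 0) | x in [set x : 'cV[R]_n | x != 0]].

Definition times0 (F : set (set 'cV[R]_n)) : set (set 'cV[R]_(n + 1)) :=
  [set Proj (col_mx x 0) | x in [set x : 'cV[R]_n | x != 0 /\ F (Proj x)]].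

Definition central_chain_control_set (Omega : set 'cV[R]_m)
    (Ec : set (set 'cV[R]_(n + 1))) : Prop :=
  unique (fun E => chain_control_set Omega (proj_system embed) E /\
                   E `&` Pn1 !=set0) Ec.

End Affine.

(* Main.v *)
(** Lift a chain in projective space to the closed hemisphere by representing
    every point with nonnegative last coordinate. The lifted chain breaks only
    at jumps from some [z] to a point near [- z]; then [z] is near the equator.
    For a sequence of chains with [eps -> 0] and [T -> oo], the first and the
    last breaking points accumulate at equatorial points over the central
    chain control set, hence over its intersection with [Pn0]. Such points,
    antipodal ones included, are joined by chains of the homogeneous part,
    because the preimage of [Ehom] is a single chain control set. Hence the
    preimage [K] of [Ec] in the closed hemisphere is chain transitive there.
    Conversely, a chain transitive subset of the hemisphere meeting the open
    hemisphere projects into [Ec], so [K] is the only chain control set off the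
    equator; this gives (i), and (ii) follows because [K] lies in each chain
    control set of the sphere that it meets off the equator. *)

Require Import Defs.
From HB Require Import structures.
From mathcomp Require Import all_boot all_order all_algebra.
From mathcomp Require Import all_classical all_reals all_analysis.
From mathcomp Require Import measurable_realfun ess_sup_inf.
From mathcomp Require Import ring lra.
From Stdlib Require Import Relation_Operators Operators_Properties.
Set Implicit Arguments.
Unset Strict Implicit.
Unset Printing Implicit Defensive.
Import Order.TTheory GRing.Theory Num.Theory.
Import numFieldNormedType.Exports.
Local Open Scope classical_set_scope.
Local Open Scope ring_scope.

(** * Euclidean norm and normalization *)

(** Moving an end of a chain to an accumulation point is asymmetric. At the final point a larger
    [eps] is enough. At the initial point a trajectory from the new point must exist and stay close
    to the old one, uniformly over all admissible controls. As [flow] is only a relation, these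
    trajectories have to be built: hence the existence theory and the growth bound for linear
    equations, valid in both time directions and with one constant [L] for all controls, which comes
    from a bound on the compact [Omega]. The two breaks are not taken from the same chains. The
    first gives an equatorial limit [e]; the last is then sought on chains from [e] to the target
    and gives [e']. The parts of the chains beyond the break stay in projective space and serve only
    to place [e] and [e'] over [Ec], by maximality of [Ec]; chains of the homogeneous part join [e]
    to [e']. *)

Section EuclideanNorm.
Variables (R : realType) (k : nat).
Implicit Types (x y : 'cV[R]_k).

Lemma coord_le_norm x i : `|x i ord0| <= `|x|.
Proof.
by rewrite /Num.norm /= mx_normrE (bigmax_sup (i, ord0)).
Qed.

Lemma norm_le_coord x (c : R) :
  0 <= c -> (forall i, `|x i ord0| <= c) -> `|x| <= c.
Proof.
move=> c0 h; rewrite /Num.norm /= mx_normrE; apply: bigmax_le => //= -[i j] _ /=.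
by rewrite (ord1 j).
Qed.

Lemma enorm_ge0 x : 0 <= enorm x.
Proof. exact: sqrtr_ge0. Qed.

Lemma enorm_sqr x : enorm x ^+ 2 = \sum_i x i ord0 ^+ 2.
Proof. by rewrite sqr_sqrtr// sumr_ge0// => i _; exact: sqr_ge0. Qed.

Lemma norm_le_enorm x : `|x| <= enorm x.
Proof.
apply: norm_le_coord; first exact: enorm_ge0.
move=> i; rewrite -(@ler_pXn2r _ 2) ?nnegrE ?enorm_ge0//.
rewrite enorm_sqr (bigD1 i)//= real_normK ?num_real//.
by rewrite lerDl sumr_ge0// => j _; exact: sqr_ge0.
Qed.

Lemma enorm_le_norm x : enorm x <= k%:R * `|x|.
Proof.
rewrite -(@ler_pXn2r _ 2) ?nnegrE ?enorm_ge0 ?mulr_ge0//.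
rewrite enorm_sqr exprMn.
apply: (@le_trans _ _ (\sum_(i < k) `|x| ^+ 2)).
  apply: ler_sum => i _; rewrite -[leLHS]real_normK ?num_real//.
  by rewrite ler_pXn2r ?nnegrE// coord_le_norm.
rewrite sumr_const card_ord -[leLHS]mulr_natl ler_wpM2r ?sqr_ge0//.
rewrite -natrX ler_nat; case: (k) => // j; exact: leq_pmulr.
Qed.

Lemma enorm_eq0 x : (enorm x == 0) = (x == 0).
Proof.
apply/eqP/eqP => [e0|->].
  apply/eqP; rewrite -normr_eq0 eq_le normr_ge0 andbT.
  by rewrite -e0 norm_le_enorm.
by rewrite -(scale0r 0) enormZ normr0 mul0r.
Qed.

Lemma enorm_gt0 x : (0 < enorm x) = (x != 0).
Proof. by rewrite lt_def enorm_ge0 andbT enorm_eq0. Qed.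

(** Factoring the difference of squares coordinatewise and dividing by [enorm x + enorm y] gives a
    Lipschitz constant without the Euclidean triangle inequality. *)
Lemma ler_dist_enorm x y : `|enorm x - enorm y| <= k%:R * `|x - y|.
Proof.
have [s0|s0] := leP (enorm x + enorm y) 0.
  have := enorm_ge0 x; have := enorm_ge0 y => y0 x0.
  have -> : enorm x = 0 by lra.
  have -> : enorm y = 0 by lra.
  by rewrite subrr normr0 mulr_ge0.
rewrite -(ler_pM2r s0) -[X in _ * X <= _](gtr0_norm s0) -normrM -subr_sqr.
rewrite !enorm_sqr -sumrB (le_trans (ler_norm_sum _ _ _))//.
apply: (@le_trans _ _ (\sum_(i < k) `|x - y| * (enorm x + enorm y))).
  apply: ler_sum => i _; rewrite subr_sqr normrM ler_pM//.
    by have := coord_le_norm (x - y) i; rewrite !mxE.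
  rewrite (le_trans (ler_normD _ _))// lerD//.
    by rewrite (le_trans (coord_le_norm _ _))// norm_le_enorm.
  by rewrite (le_trans (coord_le_norm _ _))// norm_le_enorm.
by rewrite sumr_const card_ord -[leLHS]mulr_natl mulrA.
Qed.

Definition unit_of y : 'cV[R]_k := (enorm y)^-1 *: y.

Lemma enorm_unit_of y : y != 0 -> enorm (unit_of y) = 1.
Proof.
rewrite -enorm_gt0 => y0.
by rewrite enormZ gtr0_norm ?invr_gt0// mulVf// gt_eqF.
Qed.

Lemma unit_ofZ (c : R) y : 0 < c -> unit_of (c *: y) = unit_of y.
Proof.
move=> c0; rewrite /unit_of enormZ gtr0_norm// scalerA invfM mulrAC.
by rewrite mulVf ?gt_eqF// mul1r.
Qed.

Lemma ler_dist_unit_of x y : x != 0 -> y != 0 ->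
  `|unit_of x - unit_of y| <= (1 + k%:R) * `|x - y| / enorm x.
Proof.
move=> x0 y0; have ex : 0 < enorm x by rewrite enorm_gt0.
have ey : 0 < enorm y by rewrite enorm_gt0.
have -> : unit_of x - unit_of y = (enorm x)^-1 *: (x - y) +
    ((enorm x)^-1 - (enorm y)^-1) *: y.
  by rewrite /unit_of scalerBr scalerBl addrA subrK.
rewrite (le_trans (ler_normD _ _))// !normrZ.
rewrite gtr0_norm ?invr_gt0//.
have -> : (enorm x)^-1 - (enorm y)^-1 =
          (enorm y - enorm x) / (enorm x * enorm y).
  by field; rewrite !gt_eqF.
rewrite normrM [`|(_ * _)^-1|]gtr0_norm ?invr_gt0 ?mulr_gt0// mulrDl mul1r mulrDl.
rewrite lerD//; first by rewrite mulrC.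
(* The factor [(enorm y)^-1] absorbs the norm of [y], so that only [enorm x] stays in the
   denominator. *)
apply: (@le_trans _ _ (`|enorm y - enorm x| / enorm x)).
  rewrite invfM -!mulrA ler_wpM2l// ler_piMr ?invr_ge0 ?enorm_ge0//.
  by rewrite mulrC ler_pdivrMr// mul1r norm_le_enorm.
by rewrite ler_wpM2r ?invr_ge0 ?enorm_ge0// distrC ler_dist_enorm.
Qed.

(** Bolzano-Weierstrass in the unit ball of the maximum norm, a product of segments; the transposes
    are there because [rV_compact] speaks of row vectors. *)
Lemma norm_le1_cluster (e : nat -> 'cV[R]_k) : (forall j, `|e j| <= 1) ->
  exists l, forall (d : R) (N : nat), 0 < d ->
    exists2 j, (N <= j)%N & `|e j - l| < d.
Proof.
move=> e1.
pose A (i : 'I_k) : set R := `[-1, 1]%classic.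
have cA : compact [set v : 'rV[R]_k | forall i, A i (v ord0 i)].
  by apply: rV_compact => i; exact: segment_compact.
have [|l [_ cl]] := cA ((fun j => (e j)^T) @ \oo) _.
  exists 0%N => //= j _ i; rewrite /A /= mxE in_itv/= -ler_norml.
  by rewrite (le_trans (coord_le_norm _ _)).
exists l^T => d N d0.
have [] := cl ((fun j => (e j)^T) @` [set j | (N <= j)%N]) (ball l d).
- by exists N => // j Nj; exists j.
- exact: nbhsx_ballx.
move=> _ [[j Nj <-]] ld; exists j => //.
move: ld; rewrite -ball_normE /= => ld.
rewrite distrC; apply: le_lt_trans ld.
apply: norm_le_coord => // i.
rewrite (le_trans _ (_ : `|(l - (e j)^T) ord0 i| <= _)) ?mxE//.
by rewrite [X in _ <= X]/Num.norm /= mx_normrE (bigmax_sup (ord0, i))// !mxE.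
Qed.

End EuclideanNorm.

(** * Linear equations with bounded measurable coefficients *)

Section LinearEquation.
Variable R : realType.
Notation mu := (@lebesgue_measure R).

Definition loc_integrable (f : R -> R) : Prop :=
  forall a b, mu.-integrable `[a, b] (EFin \o f).

Lemma Rintegral_chasles (f : R -> R) a b c : loc_integrable f ->
  a <= b -> b <= c ->
  \int[mu]_(t in `[a, c]) f t =
  \int[mu]_(t in `[a, b]) f t + \int[mu]_(t in `[b, c]) f t.
Proof.
move=> fi ab bc.
rewrite -(@Rintegral_itv_obnd_cbnd _ b); last first.
  apply: integrableS (fi b c) => //; by apply: subset_itvr; rewrite bnd_simp.
by rewrite -(@Rintegral_itvB _ _ (BLeft a) _ b) ?bnd_simp// addrC subrK.
Qed.

Lemma Rintegral_pt (f : R -> R) a : \int[mu]_(t in `[a, a]) f t = 0.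
Proof. by rewrite set_itv1 Rintegral_set1. Qed.

Lemma continuous_loc_integrable (f : R -> R) : continuous f -> loc_integrable f.
Proof.
move=> cf a b; apply: continuous_compact_integrable.
  exact: segment_compact.
exact: continuous_subspaceT.
Qed.

Lemma Rintegral_le_norm (f g : R -> R) a b :
  loc_integrable f -> loc_integrable g ->
  (forall t, a <= t <= b -> `|f t| <= g t) ->
  `|\int[mu]_(t in `[a, b]) f t| <= \int[mu]_(t in `[a, b]) g t.
Proof.
move=> fi gi fg; rewrite (le_trans (le_normr_Rintegral _ _))//.
apply: le_Rintegral => //.
have /integrable_abse := fi a b.
by apply: eq_integrable.
Qed.

Lemma Rintegral_itv_cst (c a b : R) : a <= b ->
  \int[mu]_(t in `[a, b]) c = c * (b - a).
Proof.
move=> ab; rewrite Rintegral_cst//= lebesgue_measure_itv/= lte_fin.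
by case: ltgtP ab => // ->; rewrite subrr.
Qed.

Variable L : R.
Hypothesis L0 : 0 < L.

(* Satisfies [L * \int_0^t weight <= weight t / 2] for [t >= 0]: in the norm
   weighted by it, the Picard iteration contracts by [1/2]. *)
Definition weight (t : R) : R := expR (2 * L * t) + expR (- (2 * L * t)).

Definition weight_prim (t : R) : R :=
  (2 * L)^-1 * (expR (2 * L * t) - expR (- (2 * L * t))).

Lemma weight_prim_derive (t : R) : is_derive t 1 weight_prim (weight t).
Proof.
rewrite /weight_prim /weight.
apply: is_derive_eq.
rewrite /GRing.scale /=.
by field; rewrite gt_eqF.
Qed.

Lemma continuous_weight : continuous weight.
Proof.
move=> t; have h : is_derive t 1 weight
   (2 * L * expR (2 * L * t) - 2 * L * expR (- (2 * L * t))).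
  rewrite /weight; apply: is_derive_eq.
  by rewrite /GRing.scale /=; ring.
apply: differentiable_continuous; apply/derivable1_diffP.
exact: (@ex_derive _ _ _ _ _ _ _ h).
Qed.

Lemma continuous_weight_prim : continuous weight_prim.
Proof.
move=> t; apply: differentiable_continuous; apply/derivable1_diffP.
exact: (@ex_derive _ _ _ _ _ _ _ (weight_prim_derive t)).
Qed.

Lemma weight_ge1 t : 1 <= weight t.
Proof.
rewrite /weight; case: (leP 0 (2 * L * t)) => h.
  have := expR_ge1Dx (2 * L * t); have := expR_gt0 (- (2 * L * t)); lra.
have := expR_ge1Dx (- (2 * L * t)); have := expR_gt0 (2 * L * t); lra.
Qed.

Lemma weight_prim_le t : `|weight_prim t| <= (2 * L)^-1 * weight t.
Proof.
rewrite normrM gtr0_norm ?invr_gt0 ?mulr_gt0//.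
rewrite ler_wpM2l ?invr_ge0 ?mulr_ge0 ?(ltW L0)//.
rewrite ler_norml /weight.
have := expR_gt0 (- (2 * L * t)); have := expR_gt0 (2 * L * t) => h1 h2.
apply/andP; split; lra.
Qed.

Lemma weight_prim0 : weight_prim 0 = 0.
Proof. by rewrite /weight_prim mulr0 oppr0 subrr mulr0. Qed.

Lemma Rintegral_weight a b : a <= b ->
  \int[mu]_(t in `[a, b]) weight t = weight_prim b - weight_prim a.
Proof.
rewrite le_eqVlt => /predU1P[->|ab]; first by rewrite Rintegral_pt subrr.
rewrite /Rintegral (@continuous_FTC2 _ _ weight_prim)//.
- apply: continuous_subspaceT; exact: continuous_weight.
- split.
  + move=> t _; exact: (@ex_derive _ _ _ _ _ _ _ (weight_prim_derive t)).
  + apply: cvg_at_right_filter; exact: continuous_weight_prim.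
  + apply: cvg_at_left_filter; exact: continuous_weight_prim.
- move=> t _; rewrite derive1E.
  exact: (@derive_val _ _ _ _ _ _ _ (weight_prim_derive t)).
Qed.

End LinearEquation.

Section LinearSolution.
Variables (R : realType) (k : nat).
Notation mu := (@lebesgue_measure R).
Implicit Types (M : R -> 'M[R]_k) (y : R -> 'cV[R]_k).

(** The integral equation of [solution] for a general coefficient [M], so that a control can be
    exchanged for one that is bounded everywhere. *)
Definition lin_sol M y : Prop :=
  continuous y /\
  forall (a b : R) (i : 'I_k), a <= b ->
    y b i ord0 - y a i ord0 = \int[mu]_(t in `[a, b]) (M t *m y t) i ord0.

Lemma continuous_coord y i : continuous y -> continuous (fun t => y t i ord0).
Proof.
move=> cy t; apply/cvgrPdist_lt => e e0.
move/cvgrPdist_lt : (cy t) => /(_ e e0).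
apply: filterS => s; apply: le_lt_trans.
by have := coord_le_norm (y t - y s) i; rewrite !mxE.
Qed.

Lemma continuous_bounded_itv y a b : continuous y ->
  exists2 K, 0 <= K & forall t, a <= t <= b -> `|y t| <= K.
Proof.
move=> cy; have [ba|ab] := ltP b a.
  by exists 0 => // t /andP[at_ tb]; have := le_trans at_ tb; rewrite leNgt ba.
have [|c _ cm] := @EVT_max R (fun t => `|y t|) a b ab.
  apply: continuous_subspaceT => t.
  exact: (cvg_norm (cy t)).
by exists `|y c| => // t tab; apply: cm; rewrite in_itv.
Qed.

Variables (M : R -> 'M[R]_k) (L : R).
Hypothesis L0 : 0 < L.
Hypothesis measM : forall i j, measurable_fun setT (fun t => M t i j).
Hypothesis boundM : forall t (w : 'cV[R]_k), `|M t *m w| <= L * `|w|.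

Lemma measurable_mulmx y i : continuous y ->
  measurable_fun setT (fun t => (M t *m y t) i ord0).
Proof.
move=> cy; rewrite (_ : (fun t => _) = fun t => \sum_j M t i j * y t j ord0).
2: by apply/funext => t; rewrite mxE.
apply: measurable_sum => j; apply: measurable_funM => //.
by apply: continuous_measurable_fun; exact: continuous_coord.
Qed.

Lemma mulmx_loc_integrable y i : continuous y ->
  loc_integrable (fun t => (M t *m y t) i ord0).
Proof.
move=> cy a b; apply: measurable_bounded_integrable => //.
- by rewrite /= lebesgue_measure_itv/=; case: ifP => _; rewrite ?ltry// -EFinB ltry.
- by apply: measurable_funTS; exact: measurable_mulmx.
- have [K K0 yK] := continuous_bounded_itv a b cy.
  exists (L * K); split; first exact: num_real.
  move=> x /ltW Kx t; rewrite /= in_itv/= => tab.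
  apply: le_trans Kx; apply: (le_trans (coord_le_norm _ _)).
  by apply: (le_trans (boundM _ _)); rewrite ler_wpM2l ?(ltW L0)// yK.
Qed.

Lemma lin_sol_dist y a b K : lin_sol M y -> 0 <= K -> a <= b ->
  (forall t, a <= t <= b -> `|y t| <= K) ->
  `|y b - y a| <= L * K * (b - a).
Proof.
move=> [cy ey] K0 ab yK; apply: norm_le_coord.
  by rewrite !mulr_ge0 ?(ltW L0)// subr_ge0.
move=> i; rewrite !mxE ey// -Rintegral_itv_cst//.
apply: Rintegral_le_norm.
- exact: mulmx_loc_integrable.
- by apply: continuous_loc_integrable => t; exact: cvg_cst.
- move=> t tab; rewrite (le_trans (coord_le_norm _ _))//.
  by rewrite (le_trans (boundM _ _))// ler_wpM2l ?(ltW L0)// yK.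
Qed.

(** At a maximum point [x] of the norm of [y] between [s] and [c], the integral equation gives a
    distance from [y x] to [y c] of at most half the norm of [y x]. This works in both time
    directions. *)
Lemma lin_sol_step y s c : lin_sol M y -> L * `|s - c| <= 2^-1 ->
  `|y s| <= 2 * `|y c|.
Proof.
move=> sy sc; have [cy _] := sy.
have mm : Num.min s c <= Num.max s c by rewrite ge_min le_max lexx.
have [|x xI xm] := @EVT_max R (fun t => `|y t|) _ _ mm.
  apply: continuous_subspaceT => t.
  exact: (cvg_norm (cy t)).
have {}xm t : Num.min s c <= t <= Num.max s c -> `|y t| <= `|y x|.
  by move=> tI; apply: xm; rewrite in_itv.
have ysx : `|y s| <= `|y x| by apply: xm; rewrite ge_min le_max lexx.
suff : `|y x| <= 2 * `|y c| by exact: le_trans.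
suff : `|y x - y c| <= 2^-1 * `|y x|.
  have := lerB_dist (y x) (y c); lra.
move: xI; rewrite in_itv/= => xI.
have xcsc : `|x - c| <= `|s - c|.
  move: xI; case: (leP s c) => h /andP[xI1 xI2].
    by rewrite !ler0_norm ?subr_le0// lerN2 lerD2r.
  by rewrite !ger0_norm ?subr_ge0 ?(ltW h)// lerD2r.
apply: (@le_trans _ _ (L * `|y x| * `|x - c|)); last first.
  by rewrite mulrAC ler_wpM2r// (le_trans _ sc)// ler_wpM2l ?(ltW L0).
have xc t : Num.min x c <= t <= Num.max x c -> Num.min s c <= t <= Num.max s c.
  move=> /andP[t1 t2]; apply/andP; split.
    apply: le_trans t1; rewrite le_min; case/andP: xI => -> _ /=.
    by rewrite ge_min lexx orbT.
  apply: (le_trans t2); rewrite ge_max; case/andP: xI => _ -> /=.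
  by rewrite le_max lexx orbT.
case: (leP c x) => cx.
  rewrite ger0_norm ?subr_ge0//; apply: lin_sol_dist => // t tI.
  by apply/xm/xc; rewrite (min_idPr cx) (max_idPl cx).
rewrite distrC [`|x - c|]distrC ger0_norm ?subr_ge0 ?(ltW cx)//.
apply: lin_sol_dist => //; first exact: ltW.
by move=> t tI; apply/xm/xc; rewrite (min_idPl (ltW cx)) (max_idPr (ltW cx)).
Qed.

(** A Gronwall estimate by repeated doubling: each of [N] steps of length at most [1 / (2 L)] costs
    a factor 2. *)
Lemma lin_sol_growth N y s c : lin_sol M y -> L * `|s - c| <= 2^-1 *+ N ->
  `|y s| <= 2 ^+ N * `|y c|.
Proof.
move=> sy; elim: N c => [|N IH] c.
  rewrite mulr0n pmulr_rle0// normr_le0 subr_eq0 => /eqP ->.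
  by rewrite expr0 mul1r.
(* [c'] is the first of [N.+1] equally long steps from [c] to [s]; the remaining distance fits the
   induction hypothesis. *)
move=> h; pose c' := c + (s - c) / N.+1%:R.
have N1 : (0 : R) < N.+1%:R by rewrite ltr0n.
have c'c : c' - c = (s - c) / N.+1%:R by rewrite /c' addrC addKr.
have sc' : s - c' = (s - c) * (N%:R / N.+1%:R).
  by rewrite /c' -natr1; field; rewrite natr1 gt_eqF.
rewrite exprSr -mulrA; apply: (le_trans (IH c' _)).
  rewrite sc' normrM mulrA (@ger0_norm _ (_ / _)) ?divr_ge0//.
  rewrite mulrA ler_pdivrMr// mulr_natr [leRHS]mulr_natr -mulrnA mulnC mulrnA.
  by rewrite lerMn2r h orbT.
rewrite ler_wpM2l ?exprn_ge0//; apply: lin_sol_step => //.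
rewrite c'c normrM (@gtr0_norm _ (_^-1)) ?invr_gt0// mulrA ler_pdivrMr//.
by rewrite mulr_natr.
Qed.

End LinearSolution.

Lemma half_pow_lt (R : realType) (c e : R) : 0 < e ->
  exists n : nat, 2^-1 ^+ n * c < e.
Proof.
move=> e0; have [n hn] : exists n : nat, c < n%:R * e.
  have [c0|c0] := ltP c 0; first by exists 0%N; rewrite mul0r.
  exists (Num.trunc (c / e)).+1.
  by rewrite -ltr_pdivrMr// truncnS_gt.
exists n; rewrite exprVn mulrC ltr_pdivrMr ?exprn_gt0//.
rewrite (lt_le_trans hn)// mulrC ler_wpM2l ?(ltW e0)//.
by rewrite -natrX ler_nat ltnW// ltn_expl.
Qed.

Lemma le_of_half_pow (R : realType) (x y c : R) :
  (forall n : nat, x <= y + 2^-1 ^+ n * c) -> x <= y.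
Proof.
move=> h; apply/ler_addgt0Pr => e /(half_pow_lt c)[n hn].
by rewrite (le_trans (h n))// lerD2l ltW.
Qed.

(** The intervals of radius [2^-1 ^+ n * C] about [u n] meet pairwise, so the supremum of their left
    ends lies in all of them. *)
Lemma geometric_limit (R : realType) (u : nat -> R) (C : R) : 0 <= C ->
  (forall n m, (n <= m)%N -> `|u m - u n| <= 2^-1 ^+ n * C) ->
  exists l, forall n, `|l - u n| <= 2^-1 ^+ n * C.
Proof.
move=> C0 uC; pose A := [set u n - 2^-1 ^+ n * C | n in [set: nat]].
have ub n m : u n - 2^-1 ^+ n * C <= u m + 2^-1 ^+ m * C.
  have p0 j : 0 <= 2^-1 ^+ j * C by rewrite mulr_ge0// exprn_ge0.
  have := p0 n; have := p0 m.
  have /orP[nm|mn] := leq_total n m.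
    by have := uC _ _ nm; rewrite ler_norml => /andP[]; lra.
  by have := uC _ _ mn; rewrite ler_norml => /andP[]; lra.
have sA : has_sup A.
  split; first by exists (u 0%N - 2^-1 ^+ 0 * C), 0%N.
  by exists (u 0%N + 2^-1 ^+ 0 * C) => _ [n _ <-].
exists (sup A) => n; rewrite ler_distl; apply/andP; split.
  by apply: ub_le_sup; [case: sA|exists n].
apply: ge_sup; first by case: sA.
by move=> _ [m _ <-].
Qed.

(** * Existence of solutions by Picard iteration *)

Section Picard.
Variables (R : realType) (k : nat) (M : R -> 'M[R]_k) (L : R).
Notation mu := (@lebesgue_measure R).
Hypothesis L0 : 0 < L.
Hypothesis measM : forall i j, measurable_fun setT (fun t => M t i j).
Hypothesis boundM : forall t (w : 'cV[R]_k), `|M t *m w| <= L * `|w|.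

(** The integral from 0 to [t] for [t] of either sign: one of the two intervals is empty or a
    point. *)
Definition oriented_integral (f : R -> R) (t : R) : R :=
  \int[mu]_(s in `[0, t]) f s - \int[mu]_(s in `[t, 0]) f s.

Lemma Rintegral_itv_rev (f : R -> R) a b : b <= a ->
  \int[mu]_(s in `[a, b]) f s = 0.
Proof.
rewrite le_eqVlt => /predU1P[->|ba]; first exact: Rintegral_pt.
by rewrite set_itv_ge ?Rintegral_set0// bnd_simp -ltNge.
Qed.

Lemma oriented_integralB (f : R -> R) a b : loc_integrable f -> a <= b ->
  oriented_integral f b - oriented_integral f a = \int[mu]_(s in `[a, b]) f s.
Proof.
move=> fi ab; rewrite /oriented_integral.
have [a0|/ltW a0] := leP 0 a.
  have b0 := le_trans a0 ab.
  rewrite (Rintegral_itv_rev _ b0) (Rintegral_itv_rev _ a0).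
  by rewrite (Rintegral_chasles fi a0 ab); ring.
rewrite (Rintegral_itv_rev _ a0); have [b0|/ltW b0] := leP 0 b.
  rewrite (Rintegral_itv_rev _ b0) (Rintegral_chasles fi a0 b0); ring.
rewrite (Rintegral_itv_rev _ b0) (Rintegral_chasles fi ab b0); ring.
Qed.

Lemma oriented_integral0 f : oriented_integral f 0 = 0.
Proof. by rewrite /oriented_integral subrr. Qed.

Let W := weight L.
Let V := weight_prim L.

Lemma weight_prim_homo a b : a <= b -> V a <= V b.
Proof.
move=> ab; rewrite -subr_ge0 -Rintegral_weight//.
by apply: Rintegral_ge0 => t _; rewrite (le_trans ler01)// weight_ge1.
Qed.

Lemma Rintegral_mulmx_le (w : R -> 'cV[R]_k) i K a b : continuous w ->
  (forall t, `|w t| <= K * W t) -> a <= b ->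
  `|\int[mu]_(s in `[a, b]) (M s *m w s) i ord0| <= L * K * (V b - V a).
Proof.
move=> cw wK ab; rewrite -Rintegral_weight//.
have cW := @continuous_weight _ L.
rewrite -RintegralZl//; last exact: continuous_loc_integrable.
apply: Rintegral_le_norm.
- exact: (mulmx_loc_integrable L0 measM boundM).
- apply: continuous_loc_integrable => t.
  by apply: cvgM; [exact: cvg_cst|exact: cW].
- move=> t _; rewrite (le_trans (coord_le_norm _ _))//.
  by rewrite (le_trans (boundM _ _))// -mulrA ler_wpM2l ?(ltW L0).
Qed.

(** The contraction in the weighted norm: integrating the bound [L * K * W] gives [L * K] times [V],
    and [V] is at most [W / (2 L)] in absolute value. *)
Lemma oriented_integral_le (w : R -> 'cV[R]_k) i K t : continuous w ->
  (forall t, `|w t| <= K * W t) -> 0 <= K ->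
  `|oriented_integral (fun s => (M s *m w s) i ord0) t| <= 2^-1 * K * W t.
Proof.
move=> cw wK K0; set f := fun s => _.
have fi : loc_integrable f by exact: (mulmx_loc_integrable L0 measM boundM).
have h : `|oriented_integral f t| <= L * K * `|V t|.
  have [t0|/ltW t0] := leP 0 t.
    have := oriented_integralB fi t0; rewrite oriented_integral0 subr0 => ->.
    rewrite (le_trans (Rintegral_mulmx_le _ cw wK t0))// /V weight_prim0 subr0.
    by rewrite ler_wpM2l ?mulr_ge0 ?(ltW L0)// ler_norm.
  have := oriented_integralB fi t0; rewrite oriented_integral0 sub0r => e.
  rewrite -normrN e (le_trans (Rintegral_mulmx_le _ cw wK t0))//.
  rewrite /V weight_prim0 sub0r -normrN.
  by rewrite ler_wpM2l ?mulr_ge0 ?(ltW L0)// ler_norm.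
apply: (le_trans h); apply: (@le_trans _ _ (L * K * ((2 * L)^-1 * W t))).
  by rewrite ler_wpM2l ?mulr_ge0 ?(ltW L0)// weight_prim_le.
rewrite le_eqVlt; apply/orP; left; apply/eqP.
by field; rewrite gt_eqF.
Qed.

(** A modulus of continuity in terms of [V] is an inequality between values at two points. It
    therefore survives pointwise limits and serves both the iterates and the solution. *)
Lemma continuous_weight_dist (w : R -> 'cV[R]_k) C : 0 <= C ->
  (forall a b, a <= b -> `|w b - w a| <= C * (V b - V a)) -> continuous w.
Proof.
move=> C0 wV t; apply/cvgrPdist_lt => e e0.
have C1 : 0 < C + 1 by rewrite ltr_wpDl.
have /cvgrPdist_lt/(_ (e / (C + 1))) := @continuous_weight_prim _ _ L0 t.
rewrite divr_gt0// => /(_ isT); apply: filterS => s.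
rewrite ltr_pdivlMr// mulrC; apply: le_lt_trans.
apply: (@le_trans _ _ (C * `|V t - V s|)); last by rewrite ler_wpM2r// lerDl.
have [st|/ltW ts] := leP s t.
  by rewrite (le_trans (wV _ _ st))// ler_wpM2l// ler_norm.
by rewrite distrC [`|V t - _|]distrC (le_trans (wV _ _ ts))// ler_wpM2l// ler_norm.
Qed.

Variable v : 'cV[R]_k.

Fixpoint picard (n : nat) : R -> 'cV[R]_k :=
  if n is p.+1 then fun t => v +
    \col_i oriented_integral (fun s => (M s *m picard p s) i ord0) t
  else fun=> v.

Lemma picardE n t i : picard n.+1 t i ord0 =
  v i ord0 + oriented_integral (fun s => (M s *m picard n s) i ord0) t.
Proof. by rewrite /= !mxE. Qed.

Lemma picardB n a b i : continuous (picard n) -> a <= b ->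
  picard n.+1 b i ord0 - picard n.+1 a i ord0 =
  \int[mu]_(s in `[a, b]) (M s *m picard n s) i ord0.
Proof.
move=> cn ab; rewrite !picardE opprD addrACA subrr add0r.
by rewrite oriented_integralB//; exact: (mulmx_loc_integrable L0 measM boundM).
Qed.

Lemma picard_dist n a b : continuous (picard n) ->
  (forall t, `|picard n t| <= 2 * `|v| * W t) -> a <= b ->
  `|picard n.+1 b - picard n.+1 a| <= L * (2 * `|v|) * (V b - V a).
Proof.
move=> cn bn ab; apply: norm_le_coord.
  by rewrite !mulr_ge0 ?(ltW L0)// subr_ge0 weight_prim_homo.
move=> i; rewrite !mxE -/(picard _) .
have := picardB i cn ab; rewrite /= !mxE => ->.
exact: Rintegral_mulmx_le.
Qed.

(** The constant [K = 2 * |v|] solves [K = |v| + K / 2], hence is reproduced by the contraction.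
    Both claims go in one induction, since each of them at [n.+1] uses both at [n]. *)
Lemma picard_bound n :
  continuous (picard n) /\ forall t, `|picard n t| <= 2 * `|v| * W t.
Proof.
elim: n => [|n [cn bn]].
  split=> [t|t]; first exact: cvg_cst.
  have := weight_ge1 L t; rewrite /= -/W -mulrA => W1.
  have : `|v| <= `|v| * W t by rewrite ler_peMr.
  have := normr_ge0 v; lra.
split.
  by apply: (@continuous_weight_dist _ (L * (2 * `|v|))) => [|a b ab];
    [rewrite !mulr_ge0 ?(ltW L0)|exact: picard_dist].
move=> t; rewrite [picard n.+1 t]/= (le_trans (ler_normD _ _))//.
have : `|v| <= `|v| * W t by rewrite ler_peMr// weight_ge1.
have W0 : 0 <= W t by rewrite (le_trans ler01)// weight_ge1.
suff : `|\col_i oriented_integral (fun s => (M s *m picard n s) i ord0) t| <=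
    `|v| * W t by lra.
apply: norm_le_coord => [|i]; first by rewrite mulr_ge0.
rewrite mxE (le_trans (oriented_integral_le i t cn bn _)) ?mulr_ge0//.
by rewrite mulrA mulVf ?mul1r.
Qed.

Lemma picard_continuous n : continuous (picard n).
Proof. by case: (picard_bound n). Qed.

Lemma picard_step n t :
  `|picard n.+1 t - picard n t| <= 2^-1 ^+ n.+1 * `|v| * W t.
Proof.
have W0 s : 0 <= W s by rewrite (le_trans ler01)// weight_ge1.
elim: n t => [|n IH] t.
  rewrite expr1 /= addrC addKr; apply: norm_le_coord => [|i].
    by rewrite !mulr_ge0.
  rewrite mxE; apply: oriented_integral_le => // [s|s]; first exact: cvg_cst.
  by rewrite ler_peMr// weight_ge1.
apply: norm_le_coord => [|i]; first by rewrite mulr_ge0// mulr_ge0// exprn_ge0.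
have cd : continuous (fun s => picard n.+1 s - picard n s).
  by move=> s; apply: cvgB; exact: picard_continuous.
have fi j := mulmx_loc_integrable L0 measM boundM i (@picard_continuous j).
have -> : (picard n.+2 t - picard n.+1 t) i ord0 = oriented_integral
    (fun s => (M s *m (picard n.+1 s - picard n s)) i ord0) t.
  rewrite mxE [X in _ + X]mxE !picardE.
  rewrite opprD addrACA subrr add0r /oriented_integral.
  have e a b : \int[mu]_(s in `[a, b]) (M s *m (picard n.+1 s - picard n s)) i ord0 =
    \int[mu]_(s in `[a, b]) (M s *m picard n.+1 s) i ord0 -
    \int[mu]_(s in `[a, b]) (M s *m picard n s) i ord0.
    rewrite -RintegralB.
    2: exact: measurable_itv.
    2: exact: fi.
    2: exact: fi.
    by apply: eq_Rintegral => s _; rewrite mulmxBr !mxE.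
  by rewrite !e; ring.
rewrite exprS -(mulrA 2^-1); exact: oriented_integral_le.
Qed.

Lemma picard_cauchy n m t : (n <= m)%N ->
  `|picard m t - picard n t| <= 2^-1 ^+ n * (`|v| * W t).
Proof.
have W0 : 0 <= W t by rewrite (le_trans ler01)// weight_ge1.
move=> /subnKC <-; move: (m - n)%N => {m} d.
(* The factor [1 - 2^-1 ^+ d] is the partial sum of the geometric series; without it the induction
   on [d] would not close. *)
apply: (@le_trans _ _ ((1 - 2^-1 ^+ d) * (2^-1 ^+ n * (`|v| * W t)))); last first.
  by rewrite ler_piMl ?mulr_ge0 ?exprn_ge0// gerBl exprn_ge0.
elim: d => [|d IH]; first by rewrite addn0 subrr normr0 expr0 subrr mul0r.
have h2 := picard_step (n + d) t; rewrite addnS.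
have h1 := ler_distD (picard (n + d) t) (picard (n + d).+1 t) (picard n t).
apply: (le_trans h1); rewrite exprS exprD in h2; rewrite exprS.
move: (`|_ - picard (n + d) t|) h2 (`|_ - picard n t|) IH => A h2 B h3.
lra.
Qed.

Lemma lin_sol_exists : exists2 y, lin_sol M y & y 0 = v.
Proof.
have W0 t : 0 <= W t by rewrite (le_trans ler01)// weight_ge1.
have /choice[y0 y0P] t : exists l : 'cV[R]_k, forall n,
    `|l - picard n t| <= 2^-1 ^+ n * (`|v| * W t).
  have /choice[l lP] (i : 'I_k) : exists l : R, forall n,
      `|l - picard n t i ord0| <= 2^-1 ^+ n * (`|v| * W t).
    apply: geometric_limit; first by rewrite mulr_ge0.
    move=> n m nm; apply: le_trans (picard_cauchy t nm).
    by have := coord_le_norm (picard m t - picard n t) i; rewrite !mxE.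
  exists (\col_i l i) => n; apply: norm_le_coord => [|i].
    by rewrite !mulr_ge0// exprn_ge0.
  by rewrite !mxE.
exists y0; last first.
  apply/eqP; rewrite -subr_eq0 -normr_le0.
  by apply: (@le_of_half_pow _ _ _ (`|v| * W 0)) => n; rewrite add0r;
    have := y0P 0 n; case: n => // n; congr (`|_ - _| <= _); 
    apply/colP => i; rewrite /= !mxE oriented_integral0 addr0.
have cy : continuous y0.
  apply: (@continuous_weight_dist _ (L * (2 * `|v|))) => [|a b ab].
    by rewrite !mulr_ge0 ?(ltW L0).
  (* The estimate for [picard n.+1] passes to the limit; the constant collects the errors at [a] and
     at [b]. *)
  apply: (@le_of_half_pow _ _ _ (2^-1 * (`|v| * W a) + 2^-1 * (`|v| * W b))) => n.
  have [cn bn] := picard_bound n; have := picard_dist cn bn ab.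
  have := y0P a n.+1; have := y0P b n.+1.
  move: (picard n.+1 a) (picard n.+1 b) => pa pb; rewrite !exprSr.
  have -> : y0 b - y0 a = (y0 b - pb) + ((pb - pa) - (y0 a - pa)).
    by apply/colP => i; rewrite !mxE; ring.
  move=> h1 h2 h3; rewrite (le_trans (ler_normD _ _))//.
  have := ler_normB (pb - pa) (y0 a - pa).
  move: `|pb - pa - _| `|pb - pa| h3 `|_ - pa| h2 `|_ - pb| h1.
  move: (W a) (W b) (V b - V a) `|v| (2^-1 ^+ n).
  move=> wa wb w nv p x1 x2 h2 x3 h3 x4 h4 h5.
  lra.
split=> // a b i ab; apply/eqP; rewrite -subr_eq0 -normr_le0.
(* The first two terms come from replacing [y0] by [picard n.+1] at the end points, the third from
   replacing it by [picard n] under the integral; the shift of the index explains the factors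
   [2^-1]. *)
set C := 2^-1 * (`|v| * W b) + 2^-1 * (`|v| * W a) + L * `|v| * (V b - V a).
apply: (@le_of_half_pow _ _ _ C) => n; rewrite add0r.
have fi := mulmx_loc_integrable L0 measM boundM i.
have cd : continuous (fun s => y0 s - picard n s).
  by move=> s; apply: cvgB; [exact: cy|exact: picard_continuous].
have e : \int[mu]_(s in `[a, b]) (M s *m (y0 s - picard n s)) i ord0 =
    \int[mu]_(s in `[a, b]) (M s *m y0 s) i ord0 -
    \int[mu]_(s in `[a, b]) (M s *m picard n s) i ord0.
  rewrite -RintegralB.
  2: exact: measurable_itv.
  2: exact: fi.
  2: exact: (fi _ (@picard_continuous n)).
  by apply: eq_Rintegral => s _; rewrite mulmxBr !mxE.
have : `|\int[mu]_(s in `[a, b]) (M s *m (y0 s - picard n s)) i ord0|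
   <= L * (2^-1 ^+ n * `|v|) * (V b - V a).
  by apply: Rintegral_mulmx_le => // t; rewrite -mulrA.
rewrite e -(picardB i (@picard_continuous n) ab).
have := y0P a n.+1; have := y0P b n.+1.
move: (picard n.+1 b) (picard n.+1 a) => pb pa.
have := coord_le_norm (y0 b - pb) i.
have := coord_le_norm (y0 a - pa) i.
rewrite !mxE !exprSr => h3 h4 h1 h2 h5.
have -> : 2^-1 ^+ n * C = 2^-1 ^+ n / 2 * (`|v| * W b) +
    2^-1 ^+ n / 2 * (`|v| * W a) + 2^-1 ^+ n * (L * `|v| * (V b - V a)).
  by rewrite /C; ring.
move: (\int[mu]_(s in _) _) h5 => I h5.
have := ler_normD (y0 b i ord0 - pb i ord0 - (y0 a i ord0 - pa i ord0))
   (- (I - (pb i ord0 - pa i ord0))).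
have := ler_normB (y0 b i ord0 - pb i ord0) (y0 a i ord0 - pa i ord0).
rewrite normrN.
have -> : y0 b i ord0 - pb i ord0 - (y0 a i ord0 - pa i ord0) -
   (I - (pb i ord0 - pa i ord0)) = y0 b i ord0 - y0 a i ord0 - I by ring.
have := le_trans h3 h2; have := le_trans h4 h1.
move: h5.
have -> : L * (2^-1 ^+ n * `|v|) * (V b - V a) = 2^-1 ^+ n * (L * `|v| * (V b - V a)) by ring.
lra.
Qed.

End Picard.

Lemma ae_filter_lebesgue (R : realType) :
  Filter (nbhs (almost_everywhere (@lebesgue_measure R))).
Proof.
exact: (@ae_filter_ringOfSetsType _ (measurableTypeR R) R (@lebesgue_measure R)).
Qed.

(* The library's instance fails to unify with [lebesgue_measure]. *)
#[local] Hint Extern 0 (Filter (nbhs (almost_everywhere _))) =>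
  (exact: ae_filter_lebesgue) : typeclass_instances.

(** * Translation of time *)

Section Translation.
Variable R : realType.
Notation mu := (@lebesgue_measure R).
Implicit Type c : R.

Lemma preimage_translate c (a b : R) : (fun t => t + c) @^-1` `[a + c, b + c] = `[a, b]%classic.
Proof. by apply/seteqP; split=> t /=; rewrite !in_itv/= !lerD2r. Qed.

Lemma measurable_translate c :
  measurable_fun setT ((fun t => t + c) : measurableTypeR R -> measurableTypeR R).
Proof.
by apply: continuous_measurable_fun => t; apply: cvgD; [exact: cvg_id|exact: cvg_cst].
Qed.

(** Both measures give a half-open interval its length, and this property determines
    [lebesgue_measure]. *)
Lemma lebesgue_measure_translate c (A : set R) : measurable A ->
  pushforward mu ((fun t => t + c) : _ -> measurableTypeR R) A = mu A.
Proof.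
have mt := measurable_translate c.
move=> mA; apply/esym/lebesgue_measure_unique => //= _ [[a b]] _ <-.
rewrite /pushforward.
rewrite (_ : _ @^-1` _ = `]a - c, b - c]%classic).
  rewrite !lebesgue_measure_itv/= !lte_fin ltrD2r; case: ifP => // _.
  by rewrite -!EFinB; congr EFin; ring.
by apply/seteqP; split=> t /=; rewrite !in_itv/= ltrBlDr lerBrDr.
Qed.

Lemma Rintegral_translate c (f : R -> R) a b : measurable_fun setT f ->
  loc_integrable (fun t => f (t + c)) ->
  \int[mu]_(t in `[a, b]) f (t + c) = \int[mu]_(t in `[a + c, b + c]) f t.
Proof.
move=> mf fi; rewrite /Rintegral; congr fine.
have mt := measurable_translate c.
have mf' : measurable_fun setT (EFin \o f) by exact/measurable_EFinP.
have mD : measurable (`[a + c, b + c] : set (measurableTypeR R)).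
  exact: measurable_itv.
have := @integral_pushforward _ _ _ _ _ _ mt mu _ _ mf' _ mD.
rewrite preimage_translate => /(_ (fi a b)) <-.
by apply: eq_measure_integral => A mA _; exact: lebesgue_measure_translate.
Qed.

Lemma ae_translate c (P : R -> Prop) :
  {ae mu, forall t, P t} -> {ae mu, forall t, P (t + c)}.
Proof.
move=> [N [mN N0 PN]].
exists ((fun t => t + c) @^-1` N); split.
- by rewrite -[X in measurable X]setTI; exact: measurable_translate.
- by have := lebesgue_measure_translate c mN; rewrite /pushforward N0.
- by move=> t /= nP; exact: PN.
Qed.

End Translation.

Section LinearSolutionAlgebra.
Variables (R : realType) (k : nat).
Notation mu := (@lebesgue_measure R).
Implicit Types (M : R -> 'M[R]_k) (y : R -> 'cV[R]_k).

Variables (M : R -> 'M[R]_k) (L : R).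
Hypothesis L0 : 0 < L.
Hypothesis measM : forall i j, measurable_fun setT (fun t => M t i j).
Hypothesis boundM : forall t (w : 'cV[R]_k), `|M t *m w| <= L * `|w|.

Lemma lin_solB y z : lin_sol M y -> lin_sol M z -> lin_sol M (fun t => y t - z t).
Proof.
move=> [cy ey] [cz ez]; split=> [t|a b i ab]; first by apply: cvgB; [exact: cy|exact: cz].
have -> : (y b - z b) i ord0 - (y a - z a) i ord0 =
   (y b i ord0 - y a i ord0) - (z b i ord0 - z a i ord0) by rewrite !mxE; ring.
rewrite ey// ez// -RintegralB.
- by apply: eq_Rintegral => t _; rewrite mulmxBr !mxE.
- exact: measurable_itv.
- exact: (mulmx_loc_integrable L0 measM boundM i cy).
- exact: (mulmx_loc_integrable L0 measM boundM i cz).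
Qed.

Lemma lin_solZ y (c : R) : lin_sol M y -> lin_sol M (fun t => c *: y t).
Proof.
move=> [cy ey]; split=> [t|a b i ab]; first by apply: cvgZr; exact: cy.
rewrite !mxE -mulrBr ey// -RintegralZl.
- by apply: eq_Rintegral => t _; rewrite -scalemxAr [RHS]mxE.
- exact: measurable_itv.
- exact: (mulmx_loc_integrable L0 measM boundM i cy).
Qed.

Lemma lin_sol_translate y (c : R) : lin_sol M y ->
  lin_sol (fun t => M (t + c)) (fun t => y (t + c)).
Proof.
move=> [cy ey].
have cyc : continuous (fun t => y (t + c)).
  move=> t; apply: (@cvg_comp _ _ _ (fun t => t + c) y _ _ _ _ (cy (t + c))).
  by apply: cvgD; [exact: cvg_id|exact: cvg_cst].
split=> // a b i ab; rewrite ey ?lerD2r//.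
rewrite -(Rintegral_translate (f := fun t => (M t *m y t) i ord0))//.
  exact: measurable_mulmx.
apply: (mulmx_loc_integrable (M := fun t => M (t + c)) L0) => //.
move=> i' j'; apply: (measurableT_comp (measM i' j')).
exact: measurable_translate.
Qed.

End LinearSolutionAlgebra.

(** * Admissible controls *)

Section Controls.
Variables (R : realType) (m : nat).
Notation mu := (@lebesgue_measure R).

Definition bounded_control (C : R) (u : control R m) : Prop :=
  (forall i, measurable_fun setT (fun t => u t i ord0)) /\
  forall t i, `|u t i ord0| <= C.

Variable Omega : set 'cV[R]_m.
Variable C : R.
Hypothesis C0 : 0 <= C.
Hypothesis OmegaC : forall v, Omega v -> `|v| <= C.

Lemma admissible_translate (u : control R m) c :
  admissible Omega u -> admissible Omega (fun t => u (t + c)).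
Proof.
move=> [Lu aeu]; split; last exact: (ae_translate c aeu).
have aec := ae_translate c aeu.
move=> i; have /andP[mu_ _] := Lu i.
rewrite inE; apply/andP; split.
  rewrite inE in mu_; rewrite inE /=.
  exact: (measurableT_comp mu_ (measurable_translate c)).
rewrite inE /= /finite_norm unlock; case: ifP => _; last exact: ltry.
(* The essential supremum of the shifted control is bounded afresh by [C], since its values lie in
   [Omega] almost everywhere. *)
apply: le_lt_trans (ltry C); apply/ess_supP.
apply: filterS aec => t /OmegaC h /=; rewrite lee_fin.
by apply: le_trans h; exact: coord_le_norm.
Qed.

(* Truncating a control changes it on a null set only, and makes the bound
   hold everywhere. *)
Lemma admissible_bounded (u : control R m) : admissible Omega u ->
  exists2 u' : control R m, bounded_control C u' & {ae mu, forall t, u' t = u t}.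
Proof.
move=> [Lu aeu].
exists (fun t => \col_i Num.max (- C) (Num.min C (u t i ord0))).
  split=> [i|t i].
    rewrite (_ : (fun t => _) = fun t => Num.max (- C) (Num.min C (u t i ord0))).
    2: by apply/funext => t; rewrite mxE.
    have /andP[mu_ _] := Lu i; rewrite inE in mu_.
    by apply: measurable_maxr => //; apply: measurable_minr.
  rewrite mxE ler_norml le_max lexx /= ge_max ge_min lexx /=.
  by rewrite andbT ge0_cp.
apply: filterS aeu => t /OmegaC h; apply/colP => i; rewrite mxE.
have := le_trans (coord_le_norm (u t) i) h; rewrite ler_norml => /andP[h1 h2].
by rewrite (min_idPr h2) (max_idPr h1).
Qed.

Variables (k : nat) (B : 'I_m.+1 -> 'M[R]_k).

Lemma measurable_rhs (u : control R m) i j : (forall i, measurable_fun setT (fun t => u t i ord0)) ->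
  measurable_fun setT (fun t => rhs B (u t) i j).
Proof.
move=> mu_; rewrite (_ : (fun t => _) = fun t => B ord0 i j +
   \sum_(l < m) u t l ord0 * B (lift ord0 l) i j).
2: by apply/funext => t; rewrite /rhs mxE summxE; congr (_ + _);
   apply: eq_bigr => l _; rewrite mxE.
apply: measurable_funD => //; apply: measurable_sum => l.
exact: measurable_funM.
Qed.

Lemma rhs_bound : exists2 L : R, 0 < L & forall v : 'cV[R]_m,
  (forall i, `|v i ord0| <= C) -> forall w : 'cV[R]_k, `|rhs B v *m w| <= L * `|w|.
Proof.
pose K i j : R := `|B ord0 i j| + \sum_(l < m) C * `|B (lift ord0 l) i j|.
have K0 i j : 0 <= K i j.
  by rewrite addr_ge0// sumr_ge0// => l _; rewrite mulr_ge0.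
(* The sum of all entry bounds dominates every row sum; adding 1 makes it positive even if all
   matrices vanish. *)
exists (1 + \sum_i \sum_j K i j).
  by rewrite ltr_pwDl// !sumr_ge0// => i _; rewrite sumr_ge0.
move=> v vC w; apply: norm_le_coord => [|i].
  by rewrite mulr_ge0// addr_ge0// sumr_ge0// => i _; rewrite sumr_ge0.
rewrite mxE (le_trans (ler_norm_sum _ _ _))//.
apply: (@le_trans _ _ ((\sum_j K i j) * `|w|)).
  rewrite mulr_suml; apply: ler_sum => j _; rewrite normrM ler_pM//.
    rewrite mxE summxE (le_trans (ler_normD _ _))// lerD2l.
    rewrite (le_trans (ler_norm_sum _ _ _))// ler_sum// => l _.
    by rewrite mxE normrM ler_wpM2r.
  exact: coord_le_norm.
rewrite ler_wpM2r// [X in 1 + X](bigD1 i)//= addrCA lerDl addr_ge0// sumr_ge0// => i' _.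
by rewrite sumr_ge0.
Qed.

Lemma solution_ae (u u' : control R m) y :
  (forall i, measurable_fun setT (fun t => u t i ord0)) ->
  (forall i, measurable_fun setT (fun t => u' t i ord0)) ->
  {ae mu, forall t, u' t = u t} -> solution B u y -> solution B u' y.
Proof.
move=> mu_ mu' ae [cy ey]; split=> // a b i ab; rewrite ey//.
have mm (w : control R m) : (forall i, measurable_fun setT (fun t => w t i ord0)) ->
    measurable_fun `[a, b] (EFin \o fun t => (rhs B (w t) *m y t) i ord0).
  move=> mw; apply/measurable_EFinP/measurable_funTS.
  apply: measurable_mulmx => // i' j; exact: measurable_rhs.
congr fine; apply: ae_eq_integral.
- exact: measurable_itv.
- exact: mm.
- exact: mm.
- by apply: filterS ae => t -> _.
Qed.

End Controls.

(** * Chains *)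

Section Chains.
Variables (R : realType) (m : nat) (Omega : set 'cV[R]_m).
Variables (X : Type) (S : csystem R m X).

Definition chain_step (eps T : R) (x y : X) : Prop :=
  [/\ states S x, states S y & exists u t z,
    [/\ admissible Omega u, T <= t, flow S t x u z & dist S z y < eps]].

Lemma chain_step_chain eps T x y : chain_step eps T x y -> chain Omega S eps T x y.
Proof.
move=> [Sx Sy [u [t [z [uO Tt xz zy]]]]].
exists 1%N, (fun j => if j is 0%N then x else y), (fun=> u), (fun=> t).
split=> //; first by case.
by case=> // _; split=> //; exists z.
Qed.

Lemma chain_cons eps T x y z :
  chain_step eps T x y -> chain Omega S eps T y z -> chain Omega S eps T x z.
Proof.
move=> [Sx Sy [u [t [w [uO Tt xw wy]]]]] [k [xs [us [ts [k1 x0 xk Sxs st]]]]].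
exists k.+1, (fun j => if j is i.+1 then xs i else x),
  (fun j => if j is i.+1 then us i else u),
  (fun j => if j is i.+1 then ts i else t); split=> //.
  by case=> // j jk; exact: Sxs.
case=> [_|j jk]; last exact: st.
by split=> //; exists w; rewrite ?x0.
Qed.

(** As chains have at least one step, they form the transitive, not the reflexive, closure. This
    gives induction from either end: from the left for the first crossing of a chain, from the right
    for the last. *)
Lemma chainP eps T x y :
  chain Omega S eps T x y <-> clos_trans_1n X (chain_step eps T) x y.
Proof.
split; last first.
  elim=> {x y} [x y|x y z xy _ yz]; first exact: chain_step_chain.
  exact: chain_cons xy yz.
move=> [k [xs [us [ts [k1 <- <- Sxs st]]]]] {x y}.
elim: k xs us ts k1 Sxs st => // k IH xs us ts _ Sxs st.
have s0 : chain_step eps T (xs 0%N) (xs 1%N).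
  have [uO Tt [z xz zy]] := st 0%N isT.
  split; [exact: Sxs|exact: Sxs|].
  by exists (us 0%N), (ts 0%N), z.
case: k => [|k] in IH Sxs st *; first exact: t1n_step.
apply: Relation_Operators.t1n_trans s0 _.
apply: (IH (fun j => xs j.+1) (fun j => us j.+1) (fun j => ts j.+1)) => // j jk.
- exact: Sxs.
- exact: st.
Qed.

Lemma chain_trans eps T x y z : chain Omega S eps T x y ->
  chain Omega S eps T y z -> chain Omega S eps T x z.
Proof.
rewrite !chainP => /(clos_t1n_trans _ _ _ _) xy /(clos_t1n_trans _ _ _ _) yz.
by apply: clos_trans_t1n; exact: t_trans xy yz.
Qed.

Lemma chain_step_mono e e' T T' x y : e <= e' -> T' <= T ->
  chain_step e T x y -> chain_step e' T' x y.
Proof.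
move=> ee TT [Sx Sy [u [t [z [uO Tt xz zy]]]]]; split=> //.
by exists u, t, z; split=> //; [exact: le_trans Tt|exact: lt_le_trans ee].
Qed.

Lemma chain_mono e e' T T' x y : e <= e' -> T' <= T ->
  chain Omega S e T x y -> chain Omega S e' T' x y.
Proof.
move=> ee TT; rewrite !chainP; elim=> {x y} [x y xy|x y z xy _ yz].
  by apply: t1n_step; exact: chain_step_mono xy.
by apply: Relation_Operators.t1n_trans yz; exact: chain_step_mono xy.
Qed.

Lemma chain_states e T x y : chain Omega S e T x y -> states S x /\ states S y.
Proof. by rewrite chainP; elim=> {x y} [x y []|x y z [] ? ? _ _ []]. Qed.

Lemma chain_right_ind e T (P : X -> X -> Prop) :
  (forall x y, chain_step e T x y -> P x y) ->
  (forall x y z, chain Omega S e T x y -> P x y -> chain_step e T y z -> P x z) ->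
  forall x y, chain Omega S e T x y -> P x y.
Proof.
move=> P1 P2 x y; rewrite chainP => /(clos_t1n_trans _ _ _ _)/(clos_trans_tn1 _ _ _ _).
elim=> {y} [y|y z yz xy Pxy]; first exact: P1.
apply: (P2 _ y) => //.
by apply/chainP/clos_trans_t1n/clos_tn1_trans.
Qed.

Lemma chain_left_ind e T (P : X -> X -> Prop) :
  (forall x y, chain_step e T x y -> P x y) ->
  (forall x y z, chain_step e T x y -> chain Omega S e T y z -> P y z -> P x z) ->
  forall x y, chain Omega S e T x y -> P x y.
Proof.
move=> P1 P2 x y; rewrite chainP.
elim=> {x y} [x y|x y z xy yz Pyz]; first exact: P1.
by apply: (P2 _ y) => //; rewrite chainP.
Qed.

Definition chain_reach (x y : X) : Prop :=
  forall eps T, 0 < eps -> 0 < T -> chain Omega S eps T x y.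

Lemma chain_reach_trans x y z : chain_reach x y -> chain_reach y z -> chain_reach x z.
Proof. by move=> xy yz e T e0 T0; exact: chain_trans (xy _ _ e0 T0) (yz _ _ e0 T0). Qed.

Lemma not_chain_reach x y : ~ chain_reach x y ->
  exists e0 T0 : R, [/\ 0 < e0, 0 < T0 & forall e T, e <= e0 -> T0 <= T ->
    ~ chain Omega S e T x y].
Proof.
move=> /existsNP[e0] /existsNP[T0] /not_implyP[e00] /not_implyP[T00] h.
exists e0, T0; split=> // e T ee TT xy; apply: h.
exact: chain_mono xy.
Qed.

(** Maximality, applied to [E] with the single point [y] added. *)
Lemma chain_control_set_mem (E : set X) x y : chain_control_set Omega S E ->
  E x -> chain_reach x y -> chain_reach y x -> E y.
Proof.
move=> [_ ES Et Emax] Ex xy yx.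
have Sy : states S y by have [] := chain_states (xy 1 1 ltr01 ltr01).
have <- : [set z | E z \/ z = y] = E.
  apply: Emax => [z Ez|z [/ES//|->//]|]; first by left.
  have reach z w : (E z \/ z = y) -> (E w \/ w = y) -> chain_reach z w.
    have Er z' w' : E z' -> E w' -> chain_reach z' w'.
      by move=> Ez Ew e T; exact: Et.
    move=> [Ez|->] [Ew|->].
    - exact: Er.
    - exact: chain_reach_trans (Er _ _ Ez Ex) xy.
    - exact: chain_reach_trans yx (Er _ _ Ex Ew).
    - exact: chain_reach_trans yx xy.
  by move=> z w Ez Ew e T; exact: reach.
by right.
Qed.

(** Chain control sets are classes of mutual reachability. This produces a chain control set through
    a given recurrent point, which the uniqueness of the central one then identifies. *)
Lemma chain_class_control_set x : chain_reach x x ->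
  chain_control_set Omega S [set y | chain_reach x y /\ chain_reach y x].
Proof.
move=> xx; split.
- by exists x.
- by move=> y [xy _]; have [] := chain_states (xy 1 1 ltr01 ltr01).
- move=> y z [_ yx] [xz _]; exact: chain_reach_trans yx xz.
- move=> E' EE' _ Et; apply/seteqP; split=> // y Ey.
  have Ex : E' x by apply: EE'.
  by split=> e T; exact: Et.
Qed.

End Chains.

(** * Projective points and their unit representatives *)

Section ProjectiveSpace.
Variables (R : realType) (k : nat).
Implicit Types x y s : 'cV[R]_k.

Lemma ProjZ (c : R) y : c != 0 -> Proj (c *: y) = Proj y.
Proof.
move=> c0; apply/seteqP; split=> _ [d /= d0 <-].
  by exists (d * c); rewrite /= ?mulf_neq0 ?scalerA.
by exists (d / c); rewrite /= ?mulf_neq0 ?invr_eq0// scalerA divfK.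
Qed.

Lemma ProjN y : Proj (- y) = Proj y.
Proof. by rewrite -scaleN1r ProjZ// oppr_eq0 oner_eq0. Qed.

Lemma Proj_eq x y : Proj x = Proj y -> exists2 c : R, c != 0 & y = c *: x.
Proof.
move=> xy; have : Proj y y by exists 1; rewrite /= ?oner_eq0 ?scale1r.
by rewrite -xy => -[c /= c0 <-]; exists c.
Qed.

Lemma sphere_neq0 s : sphere s -> s != 0.
Proof. by rewrite -enorm_gt0 /sphere /= => ->. Qed.

Lemma sphereN s : sphere s -> sphere (- s).
Proof. by rewrite /sphere /= -scaleN1r enormZ normrN1 mul1r. Qed.

Lemma sphere_norm_le1 s : sphere s -> `|s| <= 1.
Proof. by move=> <-; exact: norm_le_enorm. Qed.

Lemma sphere_unit_of y : y != 0 -> sphere (unit_of y).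
Proof. exact: enorm_unit_of. Qed.

Lemma Proj_unit_of y : y != 0 -> Proj (unit_of y) = Proj y.
Proof. by move=> y0; rewrite ProjZ// invr_eq0 enorm_eq0. Qed.

Lemma Proj_sphere_eq s s' : sphere s -> sphere s' -> Proj s = Proj s' ->
  s' = s \/ s' = - s.
Proof.
move=> s1 s1' /Proj_eq[c _ e]; move: s1'; rewrite e /sphere /= enormZ s1 mulr1.
move=> /eqP; rewrite eqr_norml ler01 andbT => /orP[]/eqP->.
  by left; rewrite scale1r.
by right; rewrite scaleN1r.
Qed.

Lemma proj_spaceP (p : set 'cV[R]_k) : proj_space p <-> exists2 s, sphere s & p = Proj s.
Proof.
split=> [[y /= y0 <-]|[s s1 ->]].
  by exists (unit_of y); [exact: sphere_unit_of|rewrite Proj_unit_of].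
by exists s => //=; exact: sphere_neq0.
Qed.

End ProjectiveSpace.

(** * Flows on spheres and projective spaces *)

Section Flow.
Variables (R : realType) (m k : nat) (B : 'I_m.+1 -> 'M[R]_k).
Notation mu := (@lebesgue_measure R).
Variables (Omega : set 'cV[R]_m) (C : R).
Hypothesis C0 : 0 <= C.
Hypothesis OmegaC : forall v, Omega v -> `|v| <= C.

Lemma admissible_measurable (u : control R m) : admissible Omega u ->
  forall i, measurable_fun setT (fun t => u t i ord0).
Proof. by move=> [Lu _] i; have /andP[+ _] := Lu i; rewrite inE. Qed.

(** [L] is chosen before the control, which makes growth bounds and perturbation radii uniform over
    all controls. *)
Lemma solution_lin_sol : exists2 L : R, 0 < L & forall u, admissible Omega u ->
  exists M : R -> 'M[R]_k, [/\ forall i j, measurable_fun setT (fun t => M t i j),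
    forall t (w : 'cV[R]_k), `|M t *m w| <= L * `|w|
    & forall y, solution B u y <-> lin_sol M y].
Proof.
have [L L0 bL] := rhs_bound C0 B; exists L => // u uO.
have [u' [mu' bu'] ae] := admissible_bounded C0 OmegaC uO.
have mu_ := admissible_measurable uO.
exists (fun t => rhs B (u' t)); split=> [i j|t w|y].
- exact: measurable_rhs.
- exact: bL.
- split=> h; first exact: (solution_ae mu_ mu' ae h).
  by apply: (solution_ae mu' mu_ _ h); apply: filterS ae => t ->.
Qed.

Lemma solution_exists u v : admissible Omega u ->
  exists2 y, solution B u y & y 0 = v.
Proof.
have [L L0 h] := solution_lin_sol => /h[M [mM bM eM]].
by have [y yM y0] := lin_sol_exists L0 mM bM v; exists y => //; exact/eM.
Qed.

Lemma solutionB u y z : admissible Omega u -> solution B u y -> solution B u z ->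
  solution B u (fun t => y t - z t).
Proof.
have [L L0 h] := solution_lin_sol => /h[M [mM bM eM]] /eM yM /eM zM.
exact/eM/(lin_solB L0).
Qed.

Lemma solutionZ u y (c : R) : admissible Omega u -> solution B u y ->
  solution B u (fun t => c *: y t).
Proof.
have [L L0 h] := solution_lin_sol => /h[M [mM bM eM]] /eM yM.
exact/eM/(lin_solZ L0).
Qed.

Lemma solution_translate u y (c : R) : admissible Omega u -> solution B u y ->
  solution B (fun t => u (t + c)) (fun t => y (t + c)).
Proof.
have [L L0 bL] := rhs_bound C0 B => uO yu.
have [u' [mu' bu'] ae] := admissible_bounded C0 OmegaC uO.
have mu_ := admissible_measurable uO.
have mc (w : control R m) : (forall i, measurable_fun setT (fun t => w t i ord0)) ->
    forall i, measurable_fun setT (fun t : R => w (t + c) i ord0).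
  by move=> mw i; apply: (measurableT_comp (mw i)); exact: measurable_translate.
apply: (solution_ae (mc _ mu') (mc _ mu_)).
  by apply: filterS (ae_translate c ae) => t ->.
apply: (lin_sol_translate (M := fun t => rhs B (u' t)) L0).
- by move=> i j; exact: measurable_rhs.
- by move=> t w; exact: bL.
- exact: (solution_ae mu_ mu' ae yu).
Qed.

Lemma solution_growth (T : R) : exists2 G : R, 0 < G & forall u y s c,
  admissible Omega u -> solution B u y -> `|s - c| <= T -> `|y s| <= G * `|y c|.
Proof.
have [L L0 h] := solution_lin_sol.
pose N := (Num.trunc (L * T / 2^-1)).+1.
exists (2 ^+ N); first by rewrite exprn_gt0.
move=> u y s c /h[M [mM bM eM]] /eM yM sT.
apply: (lin_sol_growth L0 mM bM yM).
apply: (@le_trans _ _ (L * T)); first by rewrite ler_pM2l.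
by rewrite -[leRHS]mulr_natl -ler_pdivrMr// ltW// truncnS_gt.
Qed.

(** The growth bound from time [s] to time [c]: a solution that vanishes once vanishes
    everywhere. *)
Lemma solution_neq0 u y s c : admissible Omega u -> solution B u y ->
  y c != 0 -> y s != 0.
Proof.
move=> uO yu; apply: contra_neq => ys0.
have [G _ /(_ u y c s uO yu (lexx _))] := solution_growth `|c - s|.
by rewrite ys0 normr0 mulr0 normr_le0 => /eqP.
Qed.

Lemma sphere_flow_sphere t s u z : admissible Omega u -> sphere s ->
  sphere_flow B t s u z -> sphere z.
Proof.
move=> uO s1 [y [yu y0 ->]]; apply: enorm_unit_of.
by apply: (solution_neq0 t uO yu (c := 0)); rewrite y0 sphere_neq0.
Qed.

Lemma solution_perturb (eps T : R) : 0 < eps -> 0 < T ->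
  exists2 d : R, 0 < d & forall u y p, admissible Omega u -> solution B u y ->
    sphere (y 0) -> sphere p -> `|p - y 0| < d ->
    exists z, [/\ solution B u z, z 0 = p & `|unit_of (z T) - unit_of (y T)| < eps].
Proof.
move=> e0 T0; have [G G0 growth] := solution_growth T.
(* [1 + k] comes from normalizing and the first [G] from the growth of the difference of the
   solutions. The factor [k * G] bounds [(enorm (y T))^-1], by growth backwards from [T] to the unit
   vector [y 0]. The last 1 makes [K] positive. *)
pose K := (1 + k%:R) * G * (k%:R * G) + 1 : R.
have K0 : 0 < K by rewrite ltr_wpDl// !mulr_ge0 ?addr_ge0// ltW.
exists (eps / K); first by rewrite divr_gt0.
move=> u y p uO yu y01 p1 py; have [z zu z0] := solution_exists p uO.
exists z; split=> //.
have yT : y T != 0 by apply: (solution_neq0 _ uO yu (c := 0)); exact: sphere_neq0.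
have zT : z T != 0.
  by apply: (solution_neq0 _ uO zu (c := 0)); rewrite z0; exact: sphere_neq0.
have h1 : `|y T - z T| <= G * `|p - y 0|.
  rewrite distrC -z0; apply: (growth u (fun t => z t - y t) T 0) => //.
    exact: solutionB.
  by rewrite subr0 gtr0_norm.
have h2 : 1 <= k%:R * G * enorm (y T).
  rewrite -[leLHS]y01 (le_trans (enorm_le_norm _))// -mulrA ler_wpM2l//.
  apply: (le_trans (growth u y 0 T uO yu _)); first by rewrite sub0r normrN gtr0_norm.
  by rewrite ler_pM2l// norm_le_enorm.
have eT : 0 < enorm (y T) by rewrite enorm_gt0.
have h3 : (enorm (y T))^-1 <= k%:R * G by rewrite -(ler_pM2r eT) mulVf ?gt_eqF.
rewrite distrC (le_lt_trans (ler_dist_unit_of yT zT))//.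
apply: (@le_lt_trans _ _ ((1 + k%:R) * (G * `|p - y 0|) * (k%:R * G))).
  by rewrite ler_pM ?mulr_ge0 ?addr_ge0 ?invr_ge0 ?enorm_ge0// ler_wpM2l ?addr_ge0.
have {}py : `|p - y 0| * K < eps by rewrite -ltr_pdivlMr.
apply: le_lt_trans py; rewrite /K mulrDr mulr1.
have -> : (1 + k%:R) * (G * `|p - y 0|) * (k%:R * G) =
   `|p - y 0| * ((1 + k%:R) * G * (k%:R * G)) by ring.
by rewrite lerDl.
Qed.

Section RestrictedSphere.
(** [D] will be the whole sphere, for lifts of projective chains, and the closed hemisphere. *)
Variable D : set 'cV[R]_k.
Hypothesis D_sphere : D `<=` @sphere R k.
Hypothesis D_invariant : forall t s u z, admissible Omega u -> D s ->
  sphere_flow B t s u z -> D z.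
Notation SD := (restrict_to (sphere_system B) D).

(* Continuous dependence on the initial value is uniform on bounded times
   only, so the first segment, of length at least [T + T], is cut at [T]. *)
Lemma chain_start (eps T : R) : 0 < eps -> 0 < T ->
  exists2 d : R, 0 < d & forall p q y, D p -> `|p - q| < d ->
    chain Omega SD eps (T + T) q y -> chain Omega SD eps T p y.
Proof.
move=> e0 T0; have [d d0 pert] := solution_perturb e0 T0.
have TT : T <= T + T by rewrite lerDl ltW.
exists d => // p q y Dp pq qy; move: qy p Dp pq.
have step q' y' p : chain_step Omega SD eps (T + T) q' y' -> D p -> `|p - q'| < d ->
    chain Omega SD eps T p y'.
  move=> [Dq Dy [u [t [z [uO Tt [x [xu x0 ->]] zy]]]]] Dp pq.
  have s0 : sphere (x 0) by rewrite x0; exact: D_sphere.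
  have xp : `|p - x 0| < d by rewrite x0.
  have [z0 [z0u z00 z0x]] := pert u x p uO xu s0 (D_sphere Dp) xp.
  have xT : x T != 0 by apply: (solution_neq0 _ uO xu (c := 0)); exact: sphere_neq0.
  have Dw : D (unit_of (x T)) by apply: (D_invariant uO Dq); exists x.
  apply: (@chain_cons _ _ _ _ _ _ _ _ (unit_of (x T))).
    split=> //; exists u, T, (unit_of (z0 T)); split=> //.
    by exists z0.
  apply: chain_step_chain; split=> //.
  exists (fun s => u (s + T)), (t - T), (unit_of (x t)); split=> //.
  - exact: (admissible_translate OmegaC).
  - by rewrite lerBrDr.
  (* By linearity the tail of [x], rescaled to start on the sphere, is a solution for the shifted
     control; its duration [t - T] is still at least [T]. *)
  - exists (fun s => (enorm (x T))^-1 *: x (s + T)); split.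
    + apply: solutionZ; first exact: (admissible_translate OmegaC).
      exact: solution_translate.
    + by rewrite add0r.
    + by rewrite subrK -/(unit_of _) unit_ofZ// invr_gt0 enorm_gt0.
move=> qy; elim/chain_left_ind : qy => {q y}.
  by move=> q y qy p Dp pq; exact: step qy Dp pq.
move=> q w y qw wy _ p Dp pq; apply: chain_trans (step _ _ _ qw Dp pq) _.
exact: chain_mono wy.
Qed.

Lemma chain_end (e e' T : R) p q q' : 0 <= e' -> D q' -> `|q - q'| < e' ->
  chain Omega SD e T p q -> chain Omega SD (e + e') T p q'.
Proof.
move=> e0 Dq' qq' pq; have ee : e <= e + e' by rewrite lerDl.
have step x : chain_step Omega SD e T x q -> chain_step Omega SD (e + e') T x q'.
  move=> [Dx _ [u [t [z [uO Tt xz zq]]]]]; split=> //.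
  exists u, t, z; split=> //; apply: le_lt_trans (ler_distD q _ _) _.
  exact: ltrD.
elim/chain_right_ind : pq step => {p q qq'}.
  by move=> x y xy step; apply/chain_step_chain/step.
move=> x y z xy _ yz step; apply: chain_trans (chain_mono ee (lexx T) xy) _.
exact/chain_step_chain/step.
Qed.

Lemma chain_Proj (eps T : R) s s' : chain Omega SD eps T s s' ->
  chain Omega (proj_system B) eps T (Proj s) (Proj s').
Proof.
have step x y : chain_step Omega SD eps T x y ->
    chain_step Omega (proj_system B) eps T (Proj x) (Proj y).
  move=> [/D_sphere Dx /D_sphere Dy [u [t [z [uO Tt xz zy]]]]].
  have z1 := sphere_flow_sphere uO Dx xz.
  split; [by exists x => //; exact: sphere_neq0|by exists y => //; exact: sphere_neq0|].
  exists u, t, (Proj z); split=> //.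
    case: xz => x0 [x0u x00 zx]; exists x0; split=> //.
    - by rewrite x00 sphere_neq0.
    - by rewrite x00.
    - rewrite zx -/(unit_of _) Proj_unit_of//.
      by apply: (solution_neq0 _ uO x0u (c := 0)); rewrite x00 sphere_neq0.
  by rewrite /= pdistE// gt_min zy.
elim/chain_left_ind => [x y xy|x y z xy _ yz]; first exact/chain_step_chain/step.
exact: chain_cons (step _ _ xy) yz.
Qed.

End RestrictedSphere.

(** The projective flow only gives a solution through some multiple of [s], which is rescaled to
    start at [s]; the two terms of the minimum in [pdist] become the two alternatives. *)
Lemma proj_step_lift (eps T : R) s s' : sphere s -> sphere s' ->
  chain_step Omega (proj_system B) eps T (Proj s) (Proj s') ->
  exists u t z, [/\ admissible Omega u, T <= t, sphere_flow B t s u z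
    & `|z - s'| < eps \/ `|z + s'| < eps].
Proof.
move=> s1 s1' [_ _ [u [t [p [uO Tt [y [yu y0 sy py]] ps']]]]].
have /Proj_eq[c c0 cs] := esym sy.
have zu := solutionZ c uO yu.
have yt : y t != 0 by exact: (solution_neq0 _ uO yu y0).
have zt : c *: y t != 0 by rewrite scaler_eq0 negb_or c0.
exists u, t, (unit_of (c *: y t)); split=> //.
  by exists (fun t => c *: y t); rewrite cs.
have pE : p = Proj (unit_of (c *: y t)) by rewrite Proj_unit_of// ProjZ.
move: ps'; rewrite /= pE pdistE//; last exact: sphere_unit_of.
by rewrite gt_min opprK => /orP.
Qed.

(** On the full sphere the sign of each point can be chosen so that the jump stays small, at the
    price of losing control over the sign of the last point. This transfers [chain_start] and
    [chain_end] to projective space. *)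
Lemma proj_chain_lift (eps T : R) p q : chain Omega (proj_system B) eps T p q ->
  forall s, sphere s -> p = Proj s -> exists s', [/\ sphere s', q = Proj s'
    & chain Omega (restrict_to (sphere_system B) (@sphere R k)) eps T s s'].
Proof.
have step p' q' s : chain_step Omega (proj_system B) eps T p' q' -> sphere s ->
    p' = Proj s -> exists s', [/\ sphere s', q' = Proj s'
    & chain_step Omega (restrict_to (sphere_system B) (@sphere R k)) eps T s s'].
  move=> pq s1 ps; have [_ /proj_spaceP[s' s1' qs'] _] := pq.
  move: pq; rewrite ps qs' => /(proj_step_lift s1 s1')[u [t [z [uO Tt sz]]]].
  case=> zs'; [exists s'|exists (- s')]; split=> //.
  - by split=> //; exists u, t, z.
  - exact: sphereN.
  - by rewrite ProjN.
  - split=> //; first exact: sphereN.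
    by exists u, t, z; split=> //; rewrite /= opprK.
elim/chain_left_ind => {p q} [p q pq s s1 ps|p q r pq _ IH s s1 ps].
  have [s' [s1' qs' ss']] := step _ _ _ pq s1 ps.
  by exists s'; split=> //; exact: chain_step_chain.
have [s' [s1' qs' ss']] := step _ _ _ pq s1 ps.
have [s2 [s21 rs2 s's2]] := IH _ s1' qs'.
by exists s2; split=> //; exact: chain_cons ss' s's2.
Qed.

Lemma proj_chain_start (eps T : R) : 0 < eps -> 0 < T ->
  exists2 d : R, 0 < d & forall s s' q, sphere s -> sphere s' -> `|s - s'| < d ->
    chain Omega (proj_system B) eps (T + T) (Proj s') q ->
    chain Omega (proj_system B) eps T (Proj s) q.
Proof.
move=> e0 T0.
have [d d0 dP] := chain_start (@subset_refl _ _) sphere_flow_sphere e0 T0.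
exists d => // s s' q s1 s1' ss' /proj_chain_lift/(_ _ s1' erefl)[x [x1 -> s'x]].
by apply: chain_Proj (dP _ _ _ s1 ss' s'x).
Qed.

Lemma proj_chain_end (e e' T : R) p s s' : 0 <= e' -> sphere s -> sphere s' ->
  `|s - s'| < e' -> chain Omega (proj_system B) e T p (Proj s) ->
  chain Omega (proj_system B) (e + e') T p (Proj s').
Proof.
move=> e0 s1 s1' ss' ps; have [/proj_spaceP[x x1 px] _] := chain_states ps.
move: ps; rewrite px => /proj_chain_lift/(_ _ x1 erefl)[w [w1 + xw]].
move=> /(Proj_sphere_eq s1 w1)[] ?; subst w.
  by apply: (chain_Proj (@subset_refl _ _)); exact: chain_end xw.
(* The lift ended at [- s], so its end is moved to [- s']. *)
rewrite -(ProjN s'); apply: (chain_Proj (@subset_refl _ _)).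
apply: chain_end xw => //; first exact: sphereN.
by rewrite opprK addrC distrC.
Qed.

End Flow.

(** * Folding chains into the closed hemisphere *)

Section Embedding.
Variables (R : realType) (m n : nat).
Variables (A : 'I_m.+1 -> 'M[R]_n) (a : 'I_m.+1 -> 'cV[R]_n).
Notation mu := (@lebesgue_measure R).
Notation Aa := (embed A a).
Implicit Types (x y : 'cV[R]_n) (s z : 'cV[R]_(n + 1)) (v : 'cV[R]_m).

Lemma rhs_embed_last v i l : rhs Aa v (rshift n i) l = 0.
Proof.
have e0 j : Aa j (rshift n i) l = 0 by rewrite /embed col_mxEd row_mx0 mxE.
by rewrite /rhs mxE e0 add0r summxE big1// => j _; rewrite mxE e0 mulr0.
Qed.

Lemma rhs_embed_lshift v i j : rhs Aa v (lshift 1 i) (lshift 1 j) = rhs A v i j.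
Proof.
have e0 l : Aa l (lshift 1 i) (lshift 1 j) = A l i j.
  by rewrite /embed block_mxEul.
rewrite /rhs mxE [RHS]mxE e0 !summxE; congr (_ + _).
by apply: eq_bigr => l _; rewrite mxE e0 [RHS]mxE.
Qed.

Lemma rhs_embed_mul0 v x : rhs Aa v *m col_mx x 0 = col_mx (rhs A v *m x) 0.
Proof.
apply/colP => i; rewrite mxE; case: (split_ordP i) => j ->.
  rewrite col_mxEu [RHS]mxE big_split_ord/= [X in _ + X]big1 ?addr0; last first.
    by move=> l _; rewrite col_mxEd [X in _ * X]mxE mulr0.
  by apply: eq_bigr => l _; rewrite rhs_embed_lshift col_mxEu.
by rewrite col_mxEd mxE big1// => l _; rewrite rhs_embed_last mul0r.
Qed.

Lemma last_coordZ (c : R) s : last_coord (c *: s) = c * last_coord s.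
Proof. by rewrite /last_coord mxE. Qed.

Lemma last_coordD s z : last_coord (s + z) = last_coord s + last_coord z.
Proof. by rewrite /last_coord mxE. Qed.

Lemma last_coordN s : last_coord (- s) = - last_coord s.
Proof. by rewrite /last_coord mxE. Qed.

Lemma last_coord_le_norm s : `|last_coord s| <= `|s|.
Proof. exact: coord_le_norm. Qed.

Lemma solution_last_coord u (y : R -> 'cV[R]_(n + 1)) t : solution Aa u y -> last_coord (y t) = last_coord (y 0).
Proof.
move=> [_ ey].
have const b c : b <= c -> last_coord (y c) = last_coord (y b).
  move=> bc; apply/eqP; rewrite -subr_eq0 /last_coord ey//.
  rewrite (_ : \int[mu]_(t0 in _) _ = \int[mu]_(t0 in `[b, c]) (0 : R)).
    by rewrite Rintegral_cst ?mul0r//; exact: measurable_itv.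
  apply: eq_Rintegral => r _; rewrite mxE big1// => l _.
  by rewrite rhs_embed_last mul0r.
by have [t0|/ltW t0] := leP 0 t; rewrite (const _ _ t0).
Qed.

Lemma enorm_col_mx0 x : enorm (col_mx x (0 : 'cV[R]_1)) = enorm x.
Proof.
rewrite /enorm big_split_ord/= [X in _ + X]big1 ?addr0; last first.
  by move=> i _; rewrite col_mxEd mxE expr0n.
by under eq_bigr do rewrite col_mxEu.
Qed.

Lemma norm_col_mx0 x : `|col_mx x (0 : 'cV[R]_1)| <= `|x|.
Proof.
apply: norm_le_coord => // i; case: (split_ordP i) => j ->.
  by rewrite col_mxEu coord_le_norm.
by rewrite col_mxEd mxE normr0.
Qed.

Lemma col_mx0B x y : col_mx x (0 : 'cV[R]_1) - col_mx y 0 = col_mx (x - y) 0.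
Proof. by rewrite opp_col_mx add_col_mx subr0. Qed.

Lemma solution_col_mx0 u (y : R -> 'cV[R]_n) : solution A u y ->
  solution Aa u (fun t => col_mx (y t) 0).
Proof.
move=> [cy ey]; split=> [t|b c i bc].
  apply/cvgrPdist_lt => e e0; move/cvgrPdist_lt : (cy t) => /(_ e e0).
  apply: filterS => r; apply: le_lt_trans.
  by rewrite col_mx0B; exact: norm_col_mx0.
case: (split_ordP i) => j ->.
  rewrite !col_mxEu ey//; apply: eq_Rintegral => r _.
  by rewrite rhs_embed_mul0 col_mxEu.
rewrite !col_mxEd !mxE subrr.
rewrite (_ : \int[mu]_(t0 in _) _ = \int[mu]_(t0 in `[b, c]) (0 : R)).
  by rewrite Rintegral_cst ?mul0r//; exact: measurable_itv.
by apply: eq_Rintegral => r _; rewrite rhs_embed_mul0 col_mxEd mxE.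
Qed.

Lemma closed_hemiP s : closed_hemi s <-> sphere s /\ 0 <= last_coord s.
Proof.
split=> [[[s1 /ltW]|[s1 ->]]|[s1]]; [by []|by []|].
by rewrite le_eqVlt => /predU1P[|] h; [right|left].
Qed.

Lemma closed_hemi_sphere : @closed_hemi R n `<=` @sphere R (n + 1).
Proof. by move=> s /closed_hemiP[]. Qed.

Lemma equator_closed_hemi : @equator R n `<=` @closed_hemi R n.
Proof. by move=> s; right. Qed.

Lemma equator_col_mx0 x : sphere x -> equator (col_mx x 0).
Proof.
by move=> x1; split; rewrite /sphere /= ?enorm_col_mx0// /last_coord col_mxEd mxE.
Qed.

Lemma equatorP s : equator s -> exists2 x, sphere x & s = col_mx x 0.
Proof.
move=> [s1 s0]; have e : s = col_mx (usubmx s) 0.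
  rewrite -[LHS]vsubmxK; congr col_mx; apply/colP => i.
  by rewrite !mxE (ord1 i); exact: s0.
by exists (usubmx s) => //; move: s1; rewrite /sphere /= e enorm_col_mx0 col_mxKu.
Qed.

Lemma proj_space_hemi (p : set 'cV[R]_(n + 1)) : proj_space p ->
  exists2 s, closed_hemi s & p = Proj s.
Proof.
move=> /proj_spaceP[s s1 ->]; have [s0|/ltW s0] := leP 0 (last_coord s).
  by exists s => //; exact/closed_hemiP.
exists (- s); last by rewrite ProjN.
by apply/closed_hemiP; rewrite last_coordN oppr_ge0; split=> //; exact: sphereN.
Qed.

(** Both last coordinates are nonnegative, so neither exceeds their sum. *)
Lemma closed_hemi_crossing (eps : R) z s : closed_hemi z -> closed_hemi s ->
  `|z + s| < eps -> `|last_coord z| < eps /\ `|last_coord s| < eps.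
Proof.
move=> /closed_hemiP[_ z0] /closed_hemiP[_ s0] zs.
have := le_lt_trans (last_coord_le_norm _) zs; rewrite last_coordD.
by rewrite !ger0_norm ?addr_ge0// => h; split; apply: le_lt_trans h;
  rewrite ?lerDl ?lerDr.
Qed.

Lemma equator_limit (z : nat -> 'cV[R]_(n + 1)) : (forall j, sphere (z j)) ->
  (forall j, `|last_coord (z j)| < j.+1%:R^-1) ->
  exists2 e, equator e & forall (d : R) (N : nat), 0 < d ->
    exists2 j, (N <= j)%N & `|z j - e| < d.
Proof.
move=> z1 z0; have [e eP] := norm_le1_cluster (fun j => sphere_norm_le1 (z1 j)).
exists e => //; split.
  apply/eqP; rewrite -subr_eq0 -normr_le0; apply/ler_addgt0Pr => d d0.
  have k0 : 0 < (n + 1)%:R + 1 :> R by rewrite ltr_wpDl.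
  have [j _ je] := eP (d / ((n + 1)%:R + 1)) 0%N (divr_gt0 d0 k0).
  rewrite add0r -(z1 j) distrC (le_trans (ler_dist_enorm _ _))//.
  rewrite ltr_pdivlMr// in je; apply: le_trans (ltW je).
  by rewrite mulrC ler_wpM2l// lerDl.
apply/eqP; rewrite -normr_le0; apply/ler_addgt0Pr => d d0; rewrite add0r.
have d2 : 0 < d / 2 by rewrite divr_gt0.
have [j Nj je] := eP _ (Num.trunc (d / 2)^-1) d2.
have h : j.+1%:R^-1 <= d / 2.
  rewrite -[leRHS]invrK lef_pV2 ?posrE ?invr_gt0//.
  by rewrite (le_trans (ltW (truncnS_gt _)))// ler_nat.
have e1 : last_coord e = last_coord (z j) - last_coord (z j - e).
  by rewrite last_coordD last_coordN opprD opprK addrA subrr add0r.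
rewrite e1 (le_trans (ler_normB _ _))//.
rewrite [d]splitr lerD//; first exact: le_trans (ltW (z0 j)) h.
exact: le_trans (last_coord_le_norm _) (ltW je).
Qed.

End Embedding.

Lemma eventually_small_large (R : realType) (d T : R) : 0 < d ->
  exists N : nat, forall j, (N <= j)%N -> j.+1%:R^-1 <= d /\ T <= j.+1%:R.
Proof.
move=> d0; exists (maxn (Num.trunc d^-1) (Num.trunc T)) => j.
rewrite geq_max => /andP[j1 j2]; split.
  rewrite -[leRHS]invrK lef_pV2 ?posrE ?invr_gt0//.
  by rewrite (le_trans (ltW (truncnS_gt _)))// ler_nat.
by rewrite (le_trans (ltW (truncnS_gt _)))// ler_nat.
Qed.

Section Folding.
Variables (R : realType) (m n : nat).
Variables (A : 'I_m.+1 -> 'M[R]_n) (a : 'I_m.+1 -> 'cV[R]_n).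
Variables (Omega : set 'cV[R]_m) (C : R).
Hypothesis C0 : 0 <= C.
Hypothesis OmegaC : forall v, Omega v -> `|v| <= C.
Notation Aa := (embed A a).
Notation PS := (proj_system Aa).
Notation H := (@closed_hemi R n).
Notation HS := (restrict_to (sphere_system Aa) H).
Implicit Types (s z w e : 'cV[R]_(n + 1)).

Lemma closed_hemi_invariant t s u z : admissible Omega u -> H s ->
  sphere_flow Aa t s u z -> H z.
Proof.
move=> uO /closed_hemiP[s1 s0] sz; apply/closed_hemiP.
split; first exact: (sphere_flow_sphere C0 OmegaC uO s1 sz).
case: sz => y [yu y0 ->]; rewrite last_coordZ (solution_last_coord t yu) y0.
by rewrite mulr_ge0// invr_ge0 enorm_ge0.
Qed.

Let closed_hemi_chain_Proj (eps T : R) s s' :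
  chain Omega HS eps T s s' -> chain Omega PS eps T (Proj s) (Proj s').
Proof. exact: (chain_Proj C0 OmegaC (@closed_hemi_sphere R n)). Qed.

Lemma chain_reach_Proj s s' : chain_reach Omega HS s s' ->
  chain_reach Omega PS (Proj s) (Proj s').
Proof. by move=> ss' eps T e0 T0; exact/closed_hemi_chain_Proj/ss'. Qed.

(** The trajectory cannot leave the invariant hemisphere; only the jump can. In that case the step
    is stopped at the end [z] of the trajectory, with a jump of size 0, which is why [0 < eps] is
    required. *)
Lemma proj_step_fold (eps T : R) s s' : H s -> H s' ->
  chain_step Omega PS eps T (Proj s) (Proj s') ->
  chain_step Omega HS eps T s s' \/
  exists2 z, H z /\ `|z + s'| < eps & 0 < eps -> chain_step Omega HS eps T s z.
Proof.
move=> Hs Hs' /(proj_step_lift C0 OmegaC (closed_hemi_sphere Hs)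
  (closed_hemi_sphere Hs'))[u [t [z [uO Tt sz]]]].
have Hz : H z by exact: closed_hemi_invariant uO Hs sz.
case=> zs'; [left|right]; first by split=> //; exists u, t, z.
exists z => // e0; split=> //; exists u, t, z; split=> //.
by rewrite /= subrr normr0.
Qed.

(** The hemisphere chain is kept up to the first bad jump, the projective chain from its target [w]
    on; [Proj w = q] covers a bad jump at the very end. *)
Lemma first_crossing (eps T : R) p q : 0 < eps -> chain Omega PS eps T p q ->
  forall s s', H s -> H s' -> p = Proj s -> q = Proj s' ->
  chain Omega HS eps T s s' \/
  exists z w, [/\ H z, `|last_coord z| < eps, chain Omega HS eps T s z,
    sphere w /\ `|z + w| < eps & Proj w = q \/ chain Omega PS eps T (Proj w) q].
Proof.
move=> e0; elim/chain_left_ind => {p q} [p q pq s s' Hs Hs' ps qs'|p r q pr rq IH s s' Hs Hs' ps qs'].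
  move: pq; rewrite ps qs' => /(proj_step_fold Hs Hs')[ss'|[z [Hz zs'] sz]].
    by left; exact: chain_step_chain.
  right; exists z, s'; have [z0 _] := closed_hemi_crossing Hz Hs' zs'; split=> //.
  - by apply: chain_step_chain; exact: sz.
  - by split=> //; exact: closed_hemi_sphere.
  - by left.
have [w Hw rw] : exists2 w, H w & r = Proj w.
  by apply: proj_space_hemi; case: pr.
move: pr; rewrite ps rw => /(proj_step_fold Hs Hw)[sw|[z [Hz zw] sz]].
  have [ws'|[z [w' [Hz z0 wz w'z w'q]]]] := IH _ _ Hw Hs' rw qs'.
    by left; exact: chain_cons sw ws'.
  by right; exists z, w'; split=> //; exact: chain_cons sw wz.
right; exists z, w; have [z0 _] := closed_hemi_crossing Hz Hw zw; split=> //.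
- by apply: chain_step_chain; exact: sz.
- by split=> //; exact: closed_hemi_sphere.
- by right; rewrite -rw.
Qed.

Lemma last_crossing (eps T : R) p q : 0 < eps -> chain Omega PS eps T p q ->
  forall s s', H s -> H s' -> p = Proj s -> q = Proj s' ->
  chain Omega HS eps T s s' \/
  exists w, [/\ H w, `|last_coord w| < eps, chain Omega PS eps T p (Proj w)
    & w = s' \/ chain Omega HS eps T w s'].
Proof.
move=> e0; elim/chain_right_ind => {p q} [p q pq s s' Hs Hs' ps qs'|p r q pr IH rq s s' Hs Hs' ps qs'].
  have pq' := chain_step_chain pq.
  move: pq pq'; rewrite ps qs' => /(proj_step_fold Hs Hs')[ss'|[z [Hz zs'] _]] pq.
    by left; exact: chain_step_chain.
  right; exists s'; have [_ s'0] := closed_hemi_crossing Hz Hs' zs'; split=> //.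
  by left.
have [w Hw rw] : exists2 w, H w & r = Proj w.
  by apply: proj_space_hemi; case: rq.
have pq := chain_trans pr (chain_step_chain rq).
move: rq; rewrite rw qs' => /(proj_step_fold Hw Hs')[ws'|[z [Hz zs'] _]].
  have {}ws' := chain_step_chain ws'.
  have [sw|[w' [Hw' w'0 pw' w'w]]] := IH _ _ Hs Hw ps rw.
    by left; exact: chain_trans sw ws'.
  right; exists w'; split=> //; right.
  by case: w'w => [->|w'w] //; exact: chain_trans w'w ws'.
right; exists s'; have [_ s'0] := closed_hemi_crossing Hz Hs' zs'; split=> //.
  by rewrite -qs'.
by left.
Qed.

Lemma reach_equator s s' : H s -> H s' ->
  chain_reach Omega PS (Proj s) (Proj s') ->
  chain_reach Omega PS (Proj s') (Proj s') ->
  chain_reach Omega HS s s' \/ exists e, [/\ equator e, chain_reach Omega HS s e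
    & chain_reach Omega PS (Proj e) (Proj s')].
Proof.
move=> Hs Hs' ss' s's'; have [?|] := pselect (chain_reach Omega HS s s'); first by left.
move=> nss'; have [e0 [T0 [e00 T00 no]]] := not_chain_reach nss'; right.
(* [e0] and [T0] exclude an unbroken chain for every [j], while [j.+1] drives [eps] to 0 and [T] to
   infinity. *)
pose eps (j : nat) := Num.min e0 j.+1%:R^-1; pose T (j : nat) := Num.max T0 j.+1%:R.
have eps0 j : 0 < eps j by rewrite lt_min e00 invr_gt0 ltr0n.
have Tgt0 j : 0 < T j by rewrite lt_max T00.
have /choice[zw zwP] j : exists zw : 'cV[R]_(n + 1) * 'cV[R]_(n + 1),
    [/\ H zw.1, `|last_coord zw.1| < eps j, chain Omega HS (eps j) (T j) s zw.1,
    sphere zw.2 /\ `|zw.1 + zw.2| < eps j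
    & Proj zw.2 = Proj s' \/ chain Omega PS (eps j) (T j) (Proj zw.2) (Proj s')].
  have [ss|[z [w h]]] := first_crossing (eps0 j) (ss' _ _ (eps0 j) (Tgt0 j))
    Hs Hs' erefl erefl.
    by exfalso; apply: no ss; rewrite /eps /T ?ge_min ?le_max lexx.
  by exists (z, w).
have [j|j|e e_eq eP] := @equator_limit R n (fun j => (zw j).1).
- by have [/closed_hemi_sphere] := zwP j.
- by have [_ + _ _ _] := zwP j; rewrite lt_min => /andP[].
exists e; split=> //.
- move=> d t d0 t0; have d2 : 0 < d / 2 by rewrite divr_gt0.
  have [N hN] := eventually_small_large t d2.
  have [j Nj zje] := eP _ N d2; have [h1 h2] := hN j Nj.
  have [_ _ sz _ _] := zwP j; rewrite [d]splitr.
  apply: (chain_end (D := H) (ltW d2) _ zje); first exact: equator_closed_hemi.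
  by apply: chain_mono sz; rewrite /eps /T ?ge_min ?le_max ?h1 ?h2 orbT.
- move=> d t d0 t0; have [r r0 rP] := proj_chain_start Aa C0 OmegaC d0 t0.
  have r2 : 0 < r / 2 by rewrite divr_gt0.
  have mrd : 0 < Num.min (r / 2) d by rewrite lt_min r2.
  have [N hN] := eventually_small_large (t + t) mrd.
  have [j Nj zje] := eP _ N r2; have [h1 h2] := hN j Nj.
  move: h1; rewrite le_min => /andP[h1 h3].
  have [_ _ _ [w1 zw2] wq] := zwP j.
  (* [w] is close to [- z], hence to [- e], which represents the same projective point as [e]; each
     of the two errors takes half of [r]. *)
  rewrite -(ProjN e); apply: (rP _ (zw j).2) => //.
  + by apply: sphereN; case: e_eq.
  + have -> : - e - (zw j).2 = ((zw j).1 - e) - ((zw j).1 + (zw j).2).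
      by apply/colP => i; rewrite !mxE; ring.
    rewrite (le_lt_trans (ler_normB _ _))// [r]splitr ltrD//.
    by rewrite (lt_le_trans zw2)// (le_trans _ h1)// ge_min lexx orbT.
  (* If the bad jump was the last one, no chain is left over, and recurrence of [Proj s'] supplies
     one. *)
  + case: wq => [->|]; first by apply: s's'; rewrite ?addr_gt0.
    by apply: chain_mono; rewrite /eps /T ?ge_min ?le_max ?h3 ?h2 orbT.
Qed.

Lemma equator_reach s s' : H s -> H s' -> 0 < last_coord s' ->
  chain_reach Omega PS (Proj s) (Proj s') ->
  chain_reach Omega HS s s' \/ exists e, [/\ equator e,
    chain_reach Omega PS (Proj s) (Proj e) & chain_reach Omega HS e s'].
Proof.
move=> Hs Hs' s'0 ss'; have [?|] := pselect (chain_reach Omega HS s s'); first by left.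
move=> nss'; have [e0 [T0 [e00 T00 no]]] := not_chain_reach nss'; right.
(* [eps j <= last_coord s'] rules out a crossing at the final jump *)
pose eps (j : nat) := Num.min (Num.min e0 (last_coord s')) j.+1%:R^-1.
pose T (j : nat) := Num.max T0 j.+1%:R.
have eps0 j : 0 < eps j by rewrite !lt_min e00 s'0 invr_gt0 ltr0n.
have Tgt0 j : 0 < T j by rewrite lt_max T00.
have /choice[w wP] j : exists w : 'cV[R]_(n + 1), [/\ H w, `|last_coord w| < eps j,
    chain Omega PS (eps j) (T j) (Proj s) (Proj w)
    & chain Omega HS (eps j) (T j) w s'].
  have [ss|[w [Hw w0 sw [ws'|ws']]]] := last_crossing (eps0 j)
    (ss' _ _ (eps0 j) (Tgt0 j)) Hs Hs' erefl erefl; last by exists w.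
    by exfalso; apply: no ss; rewrite /eps /T ?ge_min ?le_max lexx.
  by move: w0; rewrite ws' !lt_min gtr0_norm// ltxx andbF.
have [j|j|e e_eq eP] := @equator_limit R n w.
- by have [/closed_hemi_sphere] := wP j.
- by have [_ + _ _] := wP j; rewrite lt_min => /andP[].
exists e; split=> //.
- move=> d t d0 t0; have d2 : 0 < d / 2 by rewrite divr_gt0.
  have [N hN] := eventually_small_large t d2.
  have [j Nj zje] := eP _ N d2; have [h1 h2] := hN j Nj.
  have [Hw _ sw _] := wP j; rewrite [d]splitr.
  apply: (proj_chain_end C0 OmegaC (ltW d2) _ _ zje).
  + exact: closed_hemi_sphere.
  + by case: e_eq.
  + by apply: chain_mono sw; rewrite /eps /T ?ge_min ?le_max ?h1 ?h2 orbT.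
- move=> d t d0 t0.
  have [r r0 rP] := chain_start C0 OmegaC (@closed_hemi_sphere R n)
    closed_hemi_invariant d0 t0.
  have [N hN] := eventually_small_large (t + t) d0.
  have [j Nj zje] := eP _ N r0; have [h1 h2] := hN j Nj.
  have [_ _ _ ws'] := wP j.
  apply: (rP _ (w j)); first exact: equator_closed_hemi.
    by rewrite distrC.
  by apply: chain_mono ws'; rewrite /eps /T ?ge_min ?le_max ?h1 ?h2 ?orbT.
Qed.

End Folding.

(** * The central chain control set over the closed hemisphere *)

Section CentralSet.
Variables (R : realType) (m n : nat).
Variables (A : 'I_m.+1 -> 'M[R]_n) (a : 'I_m.+1 -> 'cV[R]_n).
Variables (Omega : set 'cV[R]_m) (C : R).
Hypothesis C0 : 0 <= C.
Hypothesis OmegaC : forall v, Omega v -> `|v| <= C.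
Notation Aa := (embed A a).
Notation PS := (proj_system Aa).
Notation H := (@closed_hemi R n).
Notation HS := (restrict_to (sphere_system Aa) H).

Lemma chain_col_mx0 (eps T : R) (x x' : 'cV[R]_n) :
  chain Omega (sphere_system A) eps T x x' ->
  chain Omega HS eps T (col_mx x 0) (col_mx x' 0).
Proof.
have step (y z : 'cV[R]_n) : chain_step Omega (sphere_system A) eps T y z ->
    chain_step Omega HS eps T (col_mx y 0) (col_mx z 0).
  move=> [y1 z1 [u [t [w [uO Tt [x0 [x0u x00 ->]] wz]]]]].
  split; [exact/equator_closed_hemi/equator_col_mx0|
          exact/equator_closed_hemi/equator_col_mx0|].
  exists u, t, (col_mx (unit_of (x0 t)) 0); split=> //.
    exists (fun t => col_mx (x0 t) 0); split.
    - exact: solution_col_mx0.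
    - by rewrite x00.
    - by rewrite enorm_col_mx0 scale_col_mx scaler0.
  by rewrite /= col_mx0B; apply: le_lt_trans wz; exact: norm_col_mx0.
elim/chain_left_ind => [y z yz|y z w yz _ zw]; first exact/chain_step_chain/step.
exact: chain_cons (step _ _ yz) zw.
Qed.

Variables (Ec : set (set 'cV[R]_(n + 1))) (Ehom : set (set 'cV[R]_n)).
Hypothesis Ec_central : central_chain_control_set A a Omega Ec.
Hypothesis Ec_Pn0 : Ec `&` @Pn0 R n = times0 Ehom.
Hypothesis Ehom_sphere :
  chain_control_set Omega (sphere_system A) (preim_sphere Ehom).

Let K : set 'cV[R]_(n + 1) := preim_sphere Ec `&` H.

Lemma equator_central_reach e e' : equator e -> equator e' ->
  Ec (Proj e) -> Ec (Proj e') -> chain_reach Omega HS e e'.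
Proof.
have mem (x : 'cV[R]_n) : sphere x -> Ec (Proj (col_mx x 0)) -> preim_sphere Ehom x.
  move=> x1 Ex; split=> //.
  have : (Ec `&` @Pn0 R n) (Proj (col_mx x 0)).
    by split=> //; exists x => //=; exact: sphere_neq0.
  rewrite Ec_Pn0 => -[x' [x'0 Ex'] /Proj_eq[c c0]].
  by rewrite scale_col_mx scaler0 => /eq_col_mx[-> _]; rewrite ProjZ.
move=> /equatorP[x x1 ->] /equatorP[x' x1' ->] Ex Ex' eps T e0 T0.
apply: chain_col_mx0; have [_ _ tr _] := Ehom_sphere.
by apply: tr => //; exact: mem.
Qed.

Lemma central_hemi_reach s s' : K s -> K s' -> chain_reach Omega HS s s'.
Proof.
move=> [[s1 Es] Hs] [[s1' Es'] Hs'].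
have [[Ec_ccs _] _] := Ec_central; have [_ _ tr _] := Ec_ccs.
have reach p q : Ec p -> Ec q -> chain_reach Omega PS p q by move=> Ep Eq e T; exact: tr.
have [?|[e [e_eq se es']]] := reach_equator C0 OmegaC Hs Hs'
  (reach _ _ Es Es') (reach _ _ Es' Es'); first by [].
have Ee : Ec (Proj e).
  apply: (chain_control_set_mem Ec_ccs Es (chain_reach_Proj C0 OmegaC se)).
  exact: chain_reach_trans es' (reach _ _ Es' Es).
apply: chain_reach_trans se _.
(* [equator_reach] needs a target off the equator; a target on it is reached from [e] by the
   homogeneous part alone. *)
have [s'0|] := ltP 0 (last_coord s'); last first.
  move/closed_hemiP : Hs' => [_ s'0] s'0'; apply: equator_central_reach => //.
  by split=> //; apply/le_anti/andP.
have [|[e' [e'_eq se' es'']]] :=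
  equator_reach C0 OmegaC (equator_closed_hemi e_eq) Hs' s'0 (reach _ _ Ee Es').
  by [].
apply: (chain_reach_trans _ es''); apply: equator_central_reach => //.
apply: (chain_control_set_mem Ec_ccs Ee se').
exact: chain_reach_trans (chain_reach_Proj C0 OmegaC es'') (reach _ _ Es' Ee).
Qed.

(** A point [s0] of [E] off the equator is recurrent, and its class in projective space is a chain
    control set meeting [Pn1]. By uniqueness this class is [Ec], and it contains the projection of
    [E]. *)
Lemma hemi_chain_transitive_central (E : set 'cV[R]_(n + 1)) :
  E `<=` H -> ~ E `<=` @equator R n -> chain_transitive Omega HS E -> E `<=` K.
Proof.
move=> EH nE Etr s Es.
have [s0 [Es0 ns0]] : exists s0, E s0 /\ ~ equator s0.
  by have /existsNP[s0 /not_implyP[? ?]] := nE; exists s0.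
have s0_gt0 : 0 < last_coord s0.
  by have /= [[]|] := EH _ Es0.
have reach x y : E x -> E y -> chain_reach Omega PS (Proj x) (Proj y).
  move=> Ex Ey; apply: (chain_reach_Proj C0 OmegaC) => e T; exact: Etr.
have [_ Ec_unique] := Ec_central.
pose cls := [set q | chain_reach Omega PS (Proj s0) q /\
  chain_reach Omega PS q (Proj s0)].
have EcE : Ec = cls.
  apply: Ec_unique; split; first by apply: chain_class_control_set; exact: reach.
  exists (Proj s0); split; first by split; exact: reach.
  (* Dividing by the last coordinate gives the affine representative of [Proj s0]. *)
  exists ((last_coord s0)^-1 *: usubmx s0) => //.
  rewrite -[in RHS](vsubmxK s0) -[RHS](@ProjZ _ _ (last_coord s0)^-1).
  2: by rewrite invr_eq0 gt_eqF.
  rewrite scale_col_mx; congr (Proj (col_mx _ _)).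
  by apply/colP => i; rewrite !mxE (ord1 i) eqxx mulVf// gt_eqF.
split; last exact: EH.
split; first exact: closed_hemi_sphere (EH _ Es).
by rewrite EcE; split; exact: reach.
Qed.

Lemma central_hemi_nonequator : exists2 s, K s & 0 < last_coord s.
Proof.
have [[_ [p [Ep [x _ xp]]]] _] := Ec_central.
pose y : 'cV[R]_(n + 1) := col_mx x 1%:M.
have y1 : last_coord y = 1 by rewrite /last_coord col_mxEd mxE eqxx.
have y0 : y != 0.
  by apply/eqP => e; move: y1; rewrite e /last_coord mxE => /esym/eqP; rewrite oner_eq0.
have s0 : 0 < last_coord (unit_of y).
  by rewrite last_coordZ y1 mulr1 invr_gt0 enorm_gt0.
exists (unit_of y) => //; split.
  by split; [exact: sphere_unit_of|rewrite Proj_unit_of// /y xp].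
by apply/closed_hemiP; split; [exact: sphere_unit_of|exact: ltW].
Qed.

Lemma central_hemi_unique : unique (fun E : set 'cV[R]_(n + 1) =>
  chain_control_set Omega HS E /\ ~ E `<=` @equator R n) K.
Proof.
have [s Ks s0] := central_hemi_nonequator.
have Ktr : chain_transitive Omega HS K.
  by move=> x y Kx Ky e T; exact: central_hemi_reach.
have neq E : E s -> ~ E `<=` @equator R n.
  by move=> Es /(_ _ Es)[_ e]; move: s0; rewrite e ltxx.
split.
  split; last exact: neq.
  split=> //; [by exists s|by move=> x []|move=> E' KE' E'H E'tr].
  apply/seteqP; split=> //.
  by apply: hemi_chain_transitive_central => //; apply: neq; exact: KE'.
move=> E [[_ EH Etr Emax] nE]; apply: Emax => //; last by move=> x [].
exact: hemi_chain_transitive_central.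
Qed.

Lemma central_hemi_subset (S : set 'cV[R]_(n + 1)) s :
  chain_control_set Omega (sphere_system Aa) S -> S s -> K s -> K `<=` S.
Proof.
move=> S_ccs Ss Ks x Kx.
have sub y z : K y -> K z -> chain_reach Omega (sphere_system Aa) y z.
  move=> Ky Kz e T e0 T0; have := central_hemi_reach Ky Kz e0 T0.
  elim/chain_left_ind => {y z Ky Kz} [y z|y z w] [/closed_hemi_sphere y1 /closed_hemi_sphere z1 h].
    exact: chain_step_chain.
  by move=> _; apply: chain_cons.
exact: (chain_control_set_mem S_ccs Ss (sub _ _ Ks Kx) (sub _ _ Kx Ks)).
Qed.

End CentralSet.

Theorem theorem10 (R : realType) (m n : nat)
  (A : 'I_m.+1 -> 'M[R]_n) (a : 'I_m.+1 -> 'cV[R]_n)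
  (Omega : set 'cV[R]_m)
  (Omega_convex : convex_set Omega)
  (Omega_compact : compact Omega)
  (Omega_nbhs : nbhs (0 : 'cV[R]_m) Omega)
  (Ec : set (set 'cV[R]_(n + 1)))
  (Ec_central : central_chain_control_set A a Omega Ec)
  (Ehom : set (set 'cV[R]_n))
  (Ehom_ccs : chain_control_set Omega (proj_system A) Ehom)
  (Ec_Pn0 : Ec `&` @Pn0 R n = times0 Ehom)
  (SE0hom : set 'cV[R]_n)
  (SE0hom_preim : preim_sphere Ehom = SE0hom)
  (SE0hom_ccs : chain_control_set Omega (sphere_system A) SE0hom) :
  (forall SEc0 : set 'cV[R]_(n + 1),
     preim_sphere Ec = SEc0 ->
     chain_control_set Omega (sphere_system (embed A a)) SEc0 ->
     unique (fun E : set 'cV[R]_(n + 1) =>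
               chain_control_set Omega
                 (restrict_to (sphere_system (embed A a)) (@closed_hemi R n)) E
               /\ ~ E `<=` @equator R n)
            (SEc0 `&` @closed_hemi R n))
  /\
  (forall SEc1 SEc2 : set 'cV[R]_(n + 1),
     chain_control_set Omega (sphere_system (embed A a)) SEc1 ->
     chain_control_set Omega (sphere_system (embed A a)) SEc2 ->
     preim_sphere Ec = SEc1 `|` SEc2 ->
     forall E : set 'cV[R]_(n + 1),
       chain_control_set Omega
         (restrict_to (sphere_system (embed A a)) (@closed_hemi R n)) E ->
       ~ E `<=` @equator R n ->
       E = SEc1 `&` @closed_hemi R n \/ E = SEc2 `&` @closed_hemi R n).
Proof.
have [C C0 OmegaC] : exists2 C : R, 0 <= C & forall v, Omega v -> `|v| <= C.
  have [M [_ hM]] := compact_bounded Omega_compact.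
  exists `|M + 1| => // v Ov; apply: hM => //.
  by rewrite (lt_le_trans _ (ler_norm _))// ltrDl.
rewrite -SE0hom_preim in SE0hom_ccs.
have K_unique := central_hemi_unique C0 OmegaC Ec_central Ec_Pn0 SE0hom_ccs.
split=> [SEc0 <- _ //|SEc1 SEc2 ccs1 ccs2 SEc E E_ccs nE].
have [_ /(_ E (conj E_ccs nE)) <-] := K_unique.
(* One point of [K] decides the alternative, because [K] lies entirely in the chain control set that
   contains this point. *)
have [s Ks _] := central_hemi_nonequator Ec_central.
have sub := central_hemi_subset C0 OmegaC Ec_central Ec_Pn0 SE0hom_ccs.
have : preim_sphere Ec s by case: Ks.
rewrite {1}SEc => -[S1s|S2s]; [left|right]; apply/seteqP; split=> x.
- by move=> Kx; split; [exact: (sub _ _ ccs1 S1s Ks)|case: Kx].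
- by move=> [S1x Hx]; split=> //; rewrite SEc; left.
- by move=> Kx; split; [exact: (sub _ _ ccs2 S2s Ks)|case: Kx].
- by move=> [S2x Hx]; split=> //; rewrite SEc; right.
Qed.
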